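(* Let $S=\{x_1,\dots,x_n\}$ be a finite set of points in general position in $\mathbb{R}^d$. For every regular triangulation $t$ of $S$ there is a finite sequence of triangulations $t=t_0,t_1,\dots,t_m=DT(S)$ of $S$, ending at the Delaunay triangulation $DT(S)$ of $S$, such that each $t_{k+1}$ is obtained from $t_k$ by a flip and $Vr(t_{k+1})<Vr(t_k)$ for all $0\le k<m$, where $Vr$ denotes the parabolic functional.
   Context: A set $S\subset\mathbb{R}^d$ with $|S|=n\ge d+1$ is in general position if no $d+1$ of its points lie on a common hyperplane and no $d+2$ of its points lie on a common sphere. A triangulation of $S$ is a triangulation of the polytope $CH(S)$ (the convex hull of $S$) whose vertices belong to $S$ (not every point of $S$ need be used as a vertex). The Delaunay triangulation $DT(S)$ is the triangulation of $S$ whose $d$-simplices are exactly the $d$-simplices with vertices in $S$ whose circumscribed sphere has no point of $S$ in its interior. A triangulation $t$ of $S$ is regular if there is a function on $CH(S)$ that is convex, piecewise linear over $t$ (i.e. affine on each simplex of $t$), and strictly convex with respect to $t$, meaning that it is given by a different affine function on each maximal cell of $t$. Flip: a set $T$ of $d+2$ points in general position in $\mathbb{R}^d$ has exactly two triangulations. If $T\subset S$, $|T|=d+2$, and one of the two triangulations of $T$ is a subcomplex of a triangulation $t$ of $S$, then a flip is the operation replacing this subcomplex by the other triangulation of $T$, giving a new triangulation of $S$. (A flip may introduce or remove a vertex.) Parabolic functional: for a triangulation $t$ of $S$ with $d$-simplices $\Delta_i$ having vertices $x_{i0},\dots,x_{id}$, $Vr(t)=\sum_i(\|x_{i0}\|^2+\dots+\|x_{id}\|^2)\operatorname{vol}(\Delta_i)$,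 with $\operatorname{vol}$ the $d$-dimensional volume and $\|\cdot\|$ the Euclidean norm. *)

(* Defs.v *)
(* MathComp / MathComp-Analysis. *)
From HB Require Import structures.
From mathcomp Require Import all_boot all_order all_algebra.
From mathcomp Require Import all_classical all_reals all_analysis.

Set Implicit Arguments.
Unset Strict Implicit.
Unset Printing Implicit Defensive.

Import Order.TTheory GRing.Theory Num.Theory.
Import numFieldNormedType.Exports.

Local Open Scope ring_scope.

Definition dot (R : realType) (d : nat) (u v : 'rV[R]_d) : R :=
  \sum_(j < d) u 0 j * v 0 j.

(* The canonical norm `|u| on 'rV[R]_d is the sup norm, not the Euclidean one. *)
Definition enorm (R : realType) (d : nat) (u : 'rV[R]_d) : R :=
  Num.sqrt (dot u u).

Definition affine (R : realType) (d : nat) (g : 'rV[R]_d -> R) : Prop :=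
  exists (a : 'rV[R]_d) (b : R), forall y, g y = dot a y + b.

(* d-dimensional Lebesgue measure on Borel sets, as the d-fold product of
   [lebesgue_measure]: each step is the integral of the measures of the
   sections, as in [product_measure1]. *)
Fixpoint volume (R : realType) (d : nat) : set 'rV[R]_d -> \bar R :=
  match d with
  | 0 => fun A => (\1_A 0)%:E
  | d'.+1 => fun A =>
      (\int[lebesgue_measure]_(s in setT)
         volume [set y : 'rV[R]_d' | A (row_mx (s%:M : 'rV[R]_1) y)]%classic)%E
  end.

(* A finite point set S = {x_0, ..., x_(n-1)} is given by an injective family
   x : 'I_n -> 'rV[R]_d; subsets of S are sets of indices. *)
Section PointConfiguration.
Variables (R : realType) (d n : nat) (x : 'I_n -> 'rV[R]_d).

Definition on_hyperplane (A : {set 'I_n}) : Prop :=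
  exists (a : 'rV[R]_d) (b : R),
    a != 0 /\ forall i, i \in A -> dot a (x i) = b.

Definition on_sphere (A : {set 'I_n}) (c : 'rV[R]_d) (r : R) : Prop :=
  forall i, i \in A -> enorm (x i - c) = r.

Definition general_position : Prop :=
  (forall A : {set 'I_n}, #|A| = d.+1 -> ~ on_hyperplane A) /\
  (forall A : {set 'I_n}, #|A| = d.+2 ->
     ~ exists (c : 'rV[R]_d) (r : R), 0 < r /\ on_sphere A c r).

Definition affinely_independent (A : {set 'I_n}) : Prop :=
  forall w : 'I_n -> R,
    \sum_(i in A) w i = 0 -> \sum_(i in A) w i *: x i = 0 ->
    forall i, i \in A -> w i = 0.

Definition hull (A : {set 'I_n}) : set 'rV[R]_d :=
  [set y | exists w : 'I_n -> R,
     [/\ forall i, i \in A -> 0 <= w i,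
         \sum_(i in A) w i = 1
       & y = \sum_(i in A) w i *: x i]]%classic.

(* A simplicial complex is the set of (the vertex sets of) all its simplices of
   all dimensions, the empty face included. Points of A need not be vertices. *)
Definition triangulation (A : {set 'I_n}) (K : {set {set 'I_n}}) : Prop :=
  [/\ forall s, s \in K -> s \subset A /\ affinely_independent s,
      forall s f : {set 'I_n}, s \in K -> f \subset s -> f \in K,
      forall s1 s2, s1 \in K -> s2 \in K ->
        (hull s1 `&` hull s2)%classic = hull (s1 :&: s2)
    & (\bigcup_(s in [set` K]) hull s)%classic = hull A].

Definition maximal_cells (K : {set {set 'I_n}}) : {set {set 'I_n}} :=
  [set s in K | #|s| == d.+1].

Definition empty_circumsphere (s : {set 'I_n}) : Prop :=
  exists (c : 'rV[R]_d) (r : R),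
    on_sphere s c r /\ forall j : 'I_n, ~ enorm (x j - c) < r.

Definition is_Delaunay (K : {set {set 'I_n}}) : Prop :=
  triangulation [set: 'I_n]%SET K /\
  forall s : {set 'I_n}, #|s| = d.+1 ->
    (s \in maximal_cells K <-> empty_circumsphere s).

Definition regular (K : {set {set 'I_n}}) : Prop :=
  exists (f : 'rV[R]_d -> R) (g : {set 'I_n} -> 'rV[R]_d -> R),
    [/\ convex_function (hull [set: 'I_n]%SET) f,
        forall s, s \in K ->
          affine (g s) /\ forall y, hull s y -> f y = g s y
      & {in maximal_cells K &, injective g}].

Definition flip (K K' : {set {set 'I_n}}) : Prop :=
  exists (T : {set 'I_n}) (K1 K2 : {set {set 'I_n}}),
    [/\ #|T| = d.+2,
        [/\ triangulation T K1, triangulation T K2 & K1 != K2],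
        K1 \subset K
      & K' = (K :\: K1) :|: K2].

Definition Vr (K : {set {set 'I_n}}) : R :=
  \sum_(s in maximal_cells K)
    (\sum_(i in s) enorm (x i) ^+ 2) * fine (volume (hull s)).

End PointConfiguration.

(* Main.v *)
Require Import Defs.
From HB Require Import structures.
From mathcomp Require Import all_boot all_order all_algebra.
From mathcomp Require Import all_classical all_reals all_analysis.
From mathcomp Require Import measurable_realfun ring lra.
Import Order.TTheory GRing.Theory Num.Theory.
Local Open Scope ring_scope.

(** The idea is to deform heights.  Heights [h] on the points have a lower
    hull: the simplices [s] with [d+1] vertices such that every other point is
    lifted strictly above the affine interpolation of [h] on [s], together
    with their faces.  If no lifted point lies on the interpolation over a
    simplex avoiding it ([generic]), the lower hull is a triangulation
    ([lower_hull_triangulation]).  A regular triangulation is the lower hull of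
    the values of its convex function, raised at the points that are not
    vertices and slightly perturbed ([regular_excess], [perturb_heights],
    [triangulation_lower_hull]).  By completing the square, the lower hull of
    the squared norms [q] is the Delaunay triangulation ([Delaunay_cell]).

    Move from [h] to [q] along the segment of heights.  The lower hull depends
    only on the signs of the affine functionals [excess s h j], the height of
    [x j] above the interpolation on [s]; up to a nonzero factor each depends
    only on the circuit [j |: s], a set of [d+2] points
    ([excess_exchange]).  After a perturbation of [h] no two circuits change
    sign at the same time ([distinct_crossings]).  When the single circuit [T]
    changes sign, either [T] is hidden below other cells and nothing happens,
    or every other point lies above the common affine interpolation over [T],
    and then the lower hull of [T] is replaced by the other triangulation of
    [T] ([crossing_flip]).  Each crossing removes one circuit from those that
    still have to change sign ([first_crossing]), whence termination.

    [Vr] decreases for the following reason.  Let [l] be the affine dependence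
    of the circuit [T].  The cell of [T] opposite to the point [i] has volume
    proportional to [`|l i|] ([circuit_volume]), and it belongs to one
    triangulation of [T] or to the other according to the sign of [l i]; so the
    two values of [Vr] differ by a positive multiple of the absolute value of
    [\sum_i l i * q i] ([crossing_Vr]).  Its sign is the one that [T] has at
    the end of the segment: heights move linearly, so a circuit changes sign at
    most once, and towards the sign given by [q].

    The volume enters only through the fact that the volume of a simplex is a
    positive finite constant times a determinant ([volume_simplex]).  It
    follows from the behaviour of iterated integrals of polyhedra under linear
    maps: shears and dilations are one-dimensional substitutions, the exchange
    of the first two coordinates is Tonelli's theorem, and these generate the
    linear group ([scales_volume_unitmx]). *)

Set Implicit Arguments.
Unset Strict Implicit.
Unset Printing Implicit Defensive.

(** * Volumes of polyhedra under affine maps *)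

Definition polyhedron (R : realType) (d m : nat) (a : 'I_m -> 'rV[R]_d)
    (b : 'I_m -> R) : set 'rV[R]_d :=
  [set y | forall j, 0 <= dot (a j) y + b j]%classic.

Definition is_polyhedron (R : realType) (d : nat) (A : set 'rV[R]_d) : Prop :=
  exists m (a : 'I_m -> 'rV[R]_d) b, A = polyhedron a b.

Definition affine_preimage (R : realType) (k d : nat) (M : 'M[R]_(k, d))
    (v : 'rV[R]_d) (A : set 'rV[R]_d) : set 'rV[R]_k :=
  [set y | A (y *m M + v)]%classic.

Section Volume.
Variable R : realType.
Implicit Types d m : nat.

Lemma volume_ge0 d (A : set 'rV[R]_d) : (0 <= volume A)%E.
Proof.
elim: d A => [|d IH] A /=; first by rewrite lee_fin.
by apply: integral_ge0 => s _; exact: IH.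
Qed.

Lemma dot_row_mx d (a : 'rV[R]_(1 + d)) (s : R) (y : 'rV[R]_d) :
  dot a (row_mx s%:M y) = a 0 0 * s + dot (rsubmx a) y.
Proof.
rewrite /dot big_split_ord /= big_ord1 row_mxEl mxE mulr1n.
congr (_ * _ + _); first by congr (a 0 _); apply: val_inj.
by apply: eq_bigr => i _; rewrite row_mxEr mxE.
Qed.

Lemma polyhedron_section d m (a : 'I_m -> 'rV[R]_(1 + d)) b (s : R) :
  [set y : 'rV[R]_d | polyhedron a b (row_mx s%:M y)]%classic =
  polyhedron (fun j => rsubmx (a j)) (fun j => a j 0 0 * s + b j).
Proof.
apply/seteqP; split=> y /= H j; have := H j; rewrite dot_row_mx; lra.
Qed.

(** The offsets depend on a parameter in an arbitrary measurable space, so that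
    the induction on the dimension can absorb each coordinate of integration
    into the parameter. *)
Lemma measurable_volume_polyhedron d m disp (T : measurableType disp)
    (a : 'I_m -> 'rV[R]_d) (f : 'I_m -> T -> R) :
  (forall j, measurable_fun [set: T] (f j)) ->
  measurable_fun [set: T] (fun t => volume (polyhedron a (f^~ t))).
Proof.
elim: d disp T a f => [|d IH] disp T a f mf.
  pose B : set T := (\bigcap_(j in [set: 'I_m]) (f j @^-1` `[0, +oo[))%classic.
  have mB : measurable B.
    apply: fin_bigcap_measurable => // j _.
    by rewrite -[X in measurable X]setTI; apply: mf.
  suff -> : (fun t => volume (polyhedron a (f^~ t))) = (fun t => (\1_B t)%:E).
    by apply/measurable_EFinP; exact: measurable_indic.
  apply/funext => t /=; rewrite !indicE; congr ((nat_of_bool _)%:R%:E).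
  apply/idP/idP; rewrite !inE /B /polyhedron /= => H j.
    by move=> _; have := H j; rewrite /= in_itv /= andbT /dot big_ord0 add0r.
  by have := H j I; rewrite /= in_itv /= andbT /dot big_ord0 add0r.
pose g (j : 'I_m) (ts : T * measurableTypeR R) : R := a j 0 0 * ts.2 + f j ts.1.
have mg j : measurable_fun setT (g j).
  apply: measurable_funD; last exact: measurableT_comp (mf j) measurable_fst.
  by apply: measurable_funM; [exact: measurable_cst|exact: measurable_snd].
have := IH _ _ (fun j => rsubmx (a j : 'rV_(1 + d))) g mg.
move=> /(measurable_fun_fubini_tonelli_F (m2 := lebesgue_measure)).
move=> /(_ (fun _ => volume_ge0 _)).
congr (measurable_fun _ _); apply/funext => t /=; rewrite /fubini_F.
apply: eq_integral => s _.
by rewrite -polyhedron_section.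
Qed.

Lemma is_polyhedron_preimage d k (M : 'M[R]_(k, d)) v (A : set 'rV[R]_d) :
  is_polyhedron A -> is_polyhedron (affine_preimage M v A).
Proof.
move=> [m [a [b ->]]].
exists m, (fun j => a j *m M^T), (fun j => dot (a j) v + b j).
apply/seteqP; split=> y /= H j; have := H j;
  suff -> : dot (a j) (y *m M + v) = dot (a j *m M^T) y + dot (a j) v by lra.
all: rewrite /dot; under eq_bigr do rewrite mxE mulrDr; rewrite big_split /=.
all: congr (_ + _); under eq_bigr do rewrite mxE mulr_sumr; rewrite exchange_big.
all: apply: eq_bigr => i _ /=; rewrite mxE mulr_suml; apply: eq_bigr => l _.
all: by rewrite mxE; ring.
Qed.

Lemma measurable_volume_section d (A : set 'rV[R]_(1 + d)) :
  is_polyhedron A ->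
  measurable_fun [set: measurableTypeR R]
    (fun s => volume [set y : 'rV[R]_d | A (row_mx s%:M y)]%classic).
Proof.
move=> [m [a [b ->]]]; under eq_fun do rewrite polyhedron_section.
apply: (@measurable_volume_polyhedron _ _ _ (measurableTypeR R) _
  (fun j s => a j 0 0 * s + b j)) => j.
apply: measurable_funD; last exact: measurable_cst.
by apply: measurable_funM; [exact: measurable_cst|exact: measurable_id].
Qed.

(** The image of the Lebesgue measure under the affine map, rescaled by [`|a|],
    agrees with the Lebesgue measure on half-open intervals, hence everywhere. *)
Lemma ge0_integral_affine (a b : R) (f : R -> \bar R) : a != 0 ->
  measurable_fun [set: measurableTypeR R] f -> (forall s, 0 <= f s)%E ->
  (\int[lebesgue_measure]_(s in setT) f (s * a + b)%R =
   (`|a|^-1)%:E * \int[lebesgue_measure]_(s in setT) f s)%E.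
Proof.
move=> a0 mf f0.
pose phi : measurableTypeR R -> measurableTypeR R := fun s => s * a + b.
have mphi : measurable_fun setT phi.
  apply: measurable_funD; last exact: measurable_cst.
  by apply: measurable_funM; [exact: measurable_id|exact: measurable_cst].
pose phi' : {mfun _ >-> _} := HB.pack phi (isMeasurableFun.Build _ _ _ _ _ mphi).
have an : (0 <= `|a|)%R by [].
pose k := NngNum an.
have E A : measurable A ->
    lebesgue_measure A = mscale k (pushforward lebesgue_measure phi') A.
  apply: lebesgue_measure_unique => X [[l r] _ <-].
  have [lr|rl] := ltP l r; last first.
    rewrite set_itv_ge ?bnd_simp -?leNgt //.
    by rewrite !measure0.
  suff: lebesgue_measure `]l, r]%classic =
    (`|a|%:E * lebesgue_measure (phi @^-1` `]l, r])%classic)%E by [].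
  have -> : (phi @^-1` `]l, r] =
     if 0 < a then `](l - b) / a, (r - b) / a]
     else `[(r - b) / a, (l - b) / a[)%classic.
    case: ifPn => ha; apply/seteqP; split => s /=; rewrite !in_itv /= /phi.
    - by rewrite ltr_pdivrMr // ler_pdivlMr // ltrBlDr lerBrDr.
    - by rewrite ltr_pdivrMr // ler_pdivlMr // ltrBlDr lerBrDr.
    - have {}ha : a < 0 by rewrite lt_neqAle a0 leNgt.
      by rewrite ler_ndivrMr // ltr_ndivlMr // ltrBlDr lerBrDr andbC.
    - have {}ha : a < 0 by rewrite lt_neqAle a0 leNgt.
      by rewrite ler_ndivrMr // ltr_ndivlMr // ltrBlDr lerBrDr andbC.
  have [ha|ha] := ltP 0 a.
    rewrite !lebesgue_measure_itv /= !lte_fin lr ltr_pM2r ?invr_gt0 //.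
    rewrite ltrD2r lr -!EFinB -EFinM gtr0_norm //; congr (_%:E).
    by field; rewrite gt_eqF.
  have {}ha : a < 0 by rewrite lt_neqAle a0.
  rewrite !lebesgue_measure_itv /= !lte_fin lr ltr_nM2r ?invr_lt0 //.
  rewrite ltrD2r lr -!EFinB -EFinM ltr0_norm //; congr (_%:E).
  by field; rewrite lt_eqF.
rewrite [in RHS](eq_measure_integral
  (mscale k (pushforward lebesgue_measure phi'))); last by move=> A mA _; exact: E.
rewrite ge0_integral_mscale //=.
rewrite ge0_integral_pushforward //.
rewrite muleA -EFinM mulVf ?normr_eq0 // mul1e preimage_setT.
by apply: eq_integral.
Qed.

(** The translation by [v] is carried along because a linear map restricted to a
    section is only affine. *)
Definition scales_volume d (M : 'M[R]_d) : Prop :=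
  forall v A, is_polyhedron A ->
    (volume (affine_preimage M v A) = (`|\det M|^-1)%:E * volume A)%E.

Lemma scales_volumeM d (M N : 'M[R]_d) :
  scales_volume M -> scales_volume N -> scales_volume (M *m N).
Proof.
move=> hM hN v A pA.
have -> : affine_preimage (M *m N) v A =
    affine_preimage M 0 (affine_preimage N v A).
  by apply/seteqP; split => y; rewrite /affine_preimage /= addr0 mulmxA.
rewrite hM; last exact: is_polyhedron_preimage.
by rewrite hN // muleA -EFinM det_mulmx normrM invfM.
Qed.

Lemma scales_volumeV d (M : 'M[R]_d) : M \in unitmx ->
  scales_volume M -> scales_volume (invmx M).
Proof.
move=> uM hM v A pA.
have pB : is_polyhedron (affine_preimage (invmx M) v A).
  exact: is_polyhedron_preimage.
have := hM (- (v *m M)) _ pB.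
have -> : affine_preimage M (- (v *m M)) (affine_preimage (invmx M) v A) = A.
  by apply/seteqP; split => y; rewrite /affine_preimage /= mulmxDl mulNmx !mulmxK // subrK.
move=> ->; rewrite muleA -EFinM det_inv normfV invrK mulfV ?mul1e //.
by rewrite normr_eq0 -unitfE -unitmxE.
Qed.

(** In the section at first coordinate [s], such a matrix acts as an invertible
    affine map of one dimension less, and it then rescales [s]. *)
Lemma scales_volume_upper d (M : 'M[R]_(1 + d)) :
  (forall N : 'M[R]_d, N \in unitmx -> scales_volume N) ->
  M \in unitmx -> dlsubmx M = 0 -> scales_volume M.
Proof.
move=> IH uM M0 v A pA.
set a := ulsubmx M 0 0; set u := ursubmx M; set N := drsubmx M.
have EM : M = block_mx a%:M u 0 N by rewrite -M0 -mx11_scalar submxK.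
have dM : \det M = a * \det N.
  by rewrite {1}EM det_ublock det_scalar1.
have /andP[a0 N0] : (a != 0) && (\det N != 0).
  by move: uM; rewrite unitmxE dM unitfE mulf_eq0 negb_or.
have uN : N \in unitmx by rewrite unitmxE unitfE.
set v0 := (lsubmx (v : 'rV_(1 + d))) 0 0; set v1 := rsubmx (v : 'rV_(1 + d)).
have Ev : v = row_mx v0%:M v1 by rewrite -mx11_scalar hsubmxK.
have E s : (volume [set y | affine_preimage M v A (row_mx s%:M y)]%classic =
   (`|\det N|^-1)%:E * volume [set y | A (row_mx (s * a + v0)%R%:M y)]%classic)%E.
  have pS : is_polyhedron [set y | A (row_mx (s * a + v0)%R%:M y)]%classic.
    have [m [a' [b ->]]] := pA; rewrite polyhedron_section.
    by eexists; eexists; eexists.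
  rewrite -(IH _ uN (s *: u + v1) _ pS); congr volume.
  have Ey y : row_mx s%:M y *m M + v =
      row_mx (s * a + v0)%:M (y *m N + (s *: u + v1)).
    rewrite EM {1}Ev mul_row_block mulmx0 addr0 add_row_mx -scalar_mxM -raddfD /=.
    by rewrite mul_scalar_mx addrCA addrA.
  by apply/seteqP; split => y; rewrite /affine_preimage /= Ey.
rewrite /=; under eq_integral do rewrite E.
have mS := measurable_volume_section pA.
have mg : measurable_fun [set: measurableTypeR R]
    ((fun s => s * a + v0) : measurableTypeR R -> measurableTypeR R).
  apply: measurable_funD; last exact: measurable_cst.
  by apply: measurable_funM; [exact: measurable_id|exact: measurable_cst].
rewrite ge0_integralZl; [|exact: measurableT|exact: measurableT_comp mS mg
  |by move=> s _; exact: volume_ge0|by rewrite lee_fin invr_ge0].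
rewrite (ge0_integral_affine v0 a0 mS) => [|s]; last exact: volume_ge0.
by rewrite muleA -EFinM dM normrM invfM mulrC.
Qed.

Lemma scales_volume0 (M : 'M[R]_0) : scales_volume M.
Proof.
move=> v A pA; rewrite det_mx00 normr1 invr1 mul1e; congr volume.
apply/seteqP; split=> y; rewrite /affine_preimage /=;
  by rewrite (thinmx0 (_ + _)) (thinmx0 y).
Qed.

Definition swap_mx d : 'M[R]_(1 + (1 + d)) :=
  block_mx 0 (row_mx 1%:M 0) (col_mx 1%:M 0) (block_mx 0 0 0 1%:M).

Lemma mul_swap_mx d (s t : R) (y : 'rV[R]_d) :
  row_mx s%:M (row_mx t%:M y) *m swap_mx d = row_mx t%:M (row_mx s%:M y).
Proof.
rewrite mul_row_block mulmx0 add0r mul_row_col mulmx1 mulmx0 addr0.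
rewrite mul_mx_row mulmx1 mulmx0 mul_row_block !mulmx0 mulmx1 !addr0 add0r.
by rewrite add_row_mx addr0 add0r.
Qed.

Lemma swap_mxK d : swap_mx d *m swap_mx d = 1%:M.
Proof.
apply/row_matrixP => i; rewrite !rowE mulmxA mulmx1.
set e := delta_mx _ _.
rewrite -[e](@hsubmxK _ _ 1) -[rsubmx e](@hsubmxK _ _ 1).
by rewrite [lsubmx e]mx11_scalar [lsubmx (rsubmx e)]mx11_scalar !mul_swap_mx.
Qed.

(** Exchanging the first two coordinates exchanges the two outer integrals. *)
Lemma scales_volume_swap d : scales_volume (1%:M : 'M[R]_(1 + (1 + d))) ->
  scales_volume (swap_mx d).
Proof.
move=> tr v A pA.
have -> : `|\det (swap_mx d)| = 1.
  apply/eqP; rewrite -(@eqrXn2 _ 2) ?normr_ge0 // expr1n -normrX expr2.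
  by rewrite -det_mulmx swap_mxK det1 normr1.
have := tr v A pA.
have /(is_polyhedron_preimage 1%:M v) := pA.
set B := affine_preimage 1%:M v A => pB.
rewrite det1 normr1 invr1 !mul1e => <-.
have -> : affine_preimage (swap_mx d) v A = affine_preimage (swap_mx d) 0 B.
  by apply/seteqP; split=> y; rewrite /B /affine_preimage /= addr0 mulmx1.
have [m [a [b EB]]] := pB.
pose f (st : measurableTypeR R * measurableTypeR R) :=
  volume [set z : 'rV[R]_d | B (row_mx st.1%:M (row_mx st.2%:M z))]%classic.
have mf : measurable_fun setT f.
  pose a' j : 'rV[R]_(1 + d) := rsubmx (a j : 'rV_(1 + (1 + d))).
  pose g (j : 'I_m) (st : measurableTypeR R * measurableTypeR R) : R :=
    a' j 0 0 * st.2 + (a j 0 0 * st.1 + b j).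
  have -> : f = fun st => volume (polyhedron (fun j => rsubmx (a' j)) (g^~ st)).
    apply/funext => -[s t]; rewrite /f EB -(polyhedron_section a'); congr volume.
    apply/seteqP; split=> y H j; have := H j; rewrite /= (dot_row_mx (a j)) -/(a' j); lra.
  apply: measurable_volume_polyhedron => j.
  apply: measurable_funD.
    apply: measurable_funM; [exact: measurable_cst|exact: measurable_snd].
  apply: measurable_funD; last exact: measurable_cst.
  by apply: measurable_funM; [exact: measurable_cst|exact: measurable_fst].
have := fubini_tonelli (m1 := lebesgue_measure) (m2 := lebesgue_measure) f mf
  (fun _ => volume_ge0 _).
rewrite /f /= => H.
rewrite [RHS]H.
apply: eq_integral => s _; apply: eq_integral => t _; congr volume.
by apply/seteqP; split=> y; rewrite /affine_preimage /= addr0 mul_swap_mx.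
Qed.

Lemma mul_lsubmx k m n1 n2 (P : 'M[R]_(k, m)) (M : 'M[R]_(m, n1 + n2)) :
  lsubmx (P *m M) = P *m lsubmx M.
Proof. by rewrite -{1}(hsubmxK M) mul_mx_row row_mxKl. Qed.

Lemma swap_mx_unit d : swap_mx d \in unitmx.
Proof. by case: (mulmx1_unit (swap_mxK d)). Qed.

(** Elimination: left multiplication by block matrices and a coordinate
    exchange clears the first column below its top entry. *)
Lemma scales_volume_unitmx d (M : 'M[R]_d) : M \in unitmx -> scales_volume M.
Proof.
elim: d M => [|d IH] M; first by move=> _; exact: scales_volume0.
move: M; rewrite -[d.+1]/(1 + d)%N => M uM.
have upper (P : 'M[R]_(1 + d)) : P \in unitmx -> dlsubmx P = 0 -> scales_volume P.
  exact: scales_volume_upper.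
have upperE a u (N : 'M[R]_d) (P := block_mx (a%:M : 'M[R]_1) u 0 N) :
    a != 0 -> N \in unitmx -> P \in unitmx /\ scales_volume P.
  move=> a0 uN; have uP : P \in unitmx.
    rewrite unitmxE det_ublock det_scalar1 unitrM unitfE a0.
    by rewrite -unitmxE.
  by split=> //; apply: upper => //; rewrite block_mxKdl.
suff [P [uP sP PM]] : exists P : 'M[R]_(1 + d),
    [/\ P \in unitmx, scales_volume P & dlsubmx (P *m M) = 0].
  rewrite -(mulKmx uP M); apply: scales_volumeM.
    exact: scales_volumeV.
  by apply: upper => //; rewrite unitmx_mul uP.
have dlE (X : 'M[R]_(1 + d)) : dlsubmx X = dsubmx (lsubmx X).
  by apply/matrixP => i j; rewrite !mxE.
have [c0|c0] := eqVneq (dlsubmx M) 0.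
  exists 1%:M; split; rewrite ?unitmx1 ?mul1mx //.
  by apply: upper; rewrite ?unitmx1 // (@scalar_mx_block _ 1) block_mxKdl.
case: d => [|d] in M uM IH upper upperE dlE c0 *.
  by rewrite flatmx0 eqxx in c0.
(* [N] sends the column [c] to a multiple [b] of the first basis vector. *)
set c := dlsubmx _ in c0; pose N := invmx (col_ebase c).
have uN : N \in unitmx by rewrite unitmx_inv col_ebase_unit.
have [b Nc] : exists b : R, N *m c = col_mx (b%:M : 'M[R]_1) 0.
  exists ((N *m c) 0 0); rewrite -[LHS](@vsubmxK _ 1 d); apply: (f_equal2 (@col_mx R 1 d 1)).
    rewrite [LHS]mx11_scalar; congr (_ %:M); rewrite mxE.
    by congr ((N *m c) _ _); apply: val_inj.
  apply/matrixP => i j; rewrite -{1}(mulmx_ebase c) /N -mulmxA.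
  rewrite mulKmx ?col_ebase_unit // !mxE big1 // => k _.
  by rewrite !mxE !ord1 mul0r.
have b0 : b != 0.
  apply: contra c0 => /eqP b0; rewrite -(mulKmx uN c) Nc b0.
  by rewrite raddf0 col_mx0 mulmx0.
pose a := (ulsubmx M) 0 0.
have LM : lsubmx M = col_mx a%:M c.
  rewrite -[LHS]vsubmxK -mx11_scalar; apply: (f_equal2 (@col_mx R _ _ 1));
  by apply/matrixP => i j; rewrite !mxE.
pose P1 : 'M[R]_(1 + (1 + d)) := block_mx (1%:M : 'M[R]_1) 0 0 N.
(* This row makes the top entry of the column vanish, leaving [b] in the
   second place, from which the coordinate exchange moves it to the top. *)
pose w : 'rV[R]_(1 + d) := row_mx (- (a / b))%:M 0.
pose P2 : 'M[R]_(1 + (1 + d)) := block_mx (1%:M : 'M[R]_1) w 0 1%:M.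
have [u1 s1] : P1 \in unitmx /\ scales_volume P1.
  by apply: upperE; rewrite ?oner_neq0.
have [u2 s2] : P2 \in unitmx /\ scales_volume P2.
  by apply: upperE; rewrite ?oner_neq0 ?unitmx1.
exists (swap_mx d *m (P2 *m P1)); split.
- by rewrite !unitmx_mul swap_mx_unit u1 u2.
- apply: scales_volumeM; last exact: scales_volumeM.
  apply: scales_volume_swap.
  by apply: upper; rewrite ?unitmx1 // (@scalar_mx_block _ 1) block_mxKdl.
rewrite dlE mul_lsubmx LM -!mulmxA mul_block_col !mul1mx !mul0mx addr0 add0r Nc.
rewrite mul_block_col mul1mx mul0mx add0r mul1mx mul_row_col mul0mx addr0.
rewrite -scalar_mxM mulNr divfK // -raddfD /= subrr raddf0.
rewrite /swap_mx mul_block_col mul0mx add0r col_mxKd mulmx0 add0r.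
by rewrite (@mul_block_col R 1 d 1 d 1) !mul0mx mulmx0 !addr0 col_mx0.
Qed.

(** * The volume of a simplex *)

Definition corner_simplex d : set 'rV[R]_d :=
  [set y | (forall j, 0 <= y 0 j) /\ \sum_j y 0 j <= 1]%classic.

Lemma is_polyhedron_corner_simplex d : is_polyhedron (@corner_simplex d).
Proof.
exists d.+1, (fun j => if unlift ord0 j is Some k then delta_mx 0 k
                       else const_mx (-1)),
  (fun j => if j == ord0 then 1 else 0).
have E0 (y : 'rV[R]_d) : dot (const_mx (-1)) y = - \sum_j y 0 j.
  by rewrite /dot -sumrN; apply: eq_bigr => i _; rewrite mxE mulN1r.
have E1 (y : 'rV[R]_d) k : dot (delta_mx 0 k) y = y 0 k.
  rewrite /dot (bigD1 k) //= mxE !eqxx mul1r big1 ?addr0 // => i ik.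
  by rewrite mxE (negbTE ik) andbF mul0r.
apply/seteqP; split=> y.
  move=> [y0 y1] j; case: unliftP => [k ->|->].
    by rewrite E1 eq_sym (negbTE (neq_lift _ _)) addr0.
  by rewrite eqxx E0; lra.
move=> H; split=> [k|].
  have := H (lift ord0 k); rewrite liftK E1 eq_sym (negbTE (neq_lift _ _)).
  by rewrite addr0.
by have := H ord0; rewrite unlift_none eqxx E0; lra.
Qed.

Lemma volume_set0 d : volume (set0 : set 'rV[R]_d) = 0%E.
Proof.
elim: d => [|d IH] /=; first by rewrite indic0.
under eq_integral do rewrite [X in volume X](_ : _ = set0) // IH.
by rewrite integral0.
Qed.

Lemma is_polyhedron_section d (A : set 'rV[R]_(1 + d)) (s : R) :
  is_polyhedron A -> is_polyhedron [set y | A (row_mx s%:M y)]%classic.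
Proof.
by move=> [m [a [b ->]]]; rewrite polyhedron_section; eexists; eexists; eexists.
Qed.

Lemma le_volume d (A B : set 'rV[R]_d) : is_polyhedron A -> is_polyhedron B ->
  (A `<=` B)%classic -> (volume A <= volume B)%E.
Proof.
elim: d A B => [|d IH] A B pA pB AB /=.
  rewrite lee_fin !indicE ler_nat; case: (boolP (0 \in A)) => // /set_mem /AB.
  by move=> B0; rewrite mem_set.
apply: ge0_le_integral => //.
- by move=> s _; exact: volume_ge0.
- exact: measurable_volume_section.
- exact: measurable_volume_section.
- move=> s _; apply: IH; [exact: is_polyhedron_section..|].
  by move=> y; exact: AB.
Qed.

Lemma integral_const_itv (k l r : R) : 0 <= k -> l <= r ->
  (\int[lebesgue_measure]_(s in setT) (k * \1_(`[l, r]%classic : set R) s)%:E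
   = (k * (r - l))%:E)%E.
Proof.
move=> k0 lr.
have mI : measurable_fun [set: measurableTypeR R]
    (fun s => (\1_(`[l, r]%classic : set R) s : R)%:E).
  apply/measurable_EFinP.
  by apply: measurable_indic; exact: measurable_itv.
under eq_integral do rewrite EFinM.
rewrite ge0_integralZl //.
rewrite integral_indic // setIT -[X in (_ * X)%E]/(lebesgue_measure `[l, r]%classic).
rewrite lebesgue_measure_itv /= lte_fin.
move: lr; rewrite le_eqVlt => /predU1P[->|->]; last by rewrite -EFinB -EFinM.
by rewrite ltxx subrr mulr0 mule0.
Qed.

Lemma corner_simplex_section d (s : R) (y : 'rV[R]_d) :
  corner_simplex (row_mx s%:M y : 'rV_(1 + d)) <->
  [/\ 0 <= s, forall j, 0 <= y 0 j & s + \sum_j y 0 j <= 1].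
Proof.
rewrite /corner_simplex /= big_split_ord /= big_ord1 row_mxEl mxE mulr1n.
under eq_bigr do rewrite row_mxEr.
split=> [[H ?]|[s0 y0 ?]].
  split=> // [|j]; first by have := H (lshift d 0); rewrite row_mxEl mxE.
  by have := H (rshift 1 j); rewrite row_mxEr.
split=> // j; case: (split_ordP j) => k ->; rewrite ?row_mxEl ?row_mxEr //.
by rewrite mxE ord1 mulr1n.
Qed.

(** The bounds propagate by induction on the dimension: the sections at first
    coordinate [s] between 0 and 1/2 contain the corner simplex scaled by one
    half, and the sections at [s] in the unit interval, the only nonempty
    ones, are contained in the corner simplex. *)
Lemma volume_corner_simplex d :
  (0 < volume (@corner_simplex d) /\ volume (@corner_simplex d) < +oo)%E.
Proof.
elim: d => [|d [IH0 IHy]].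
  rewrite /= indicE mem_set ?lte_fin ?ltr01 ?ltry //.
  by split=> [j|]; [rewrite mxE|rewrite big_ord0].
set c := volume _ in IH0 IHy.
have cE : c = (fine c)%:E by rewrite fineK // ge0_fin_numE // ltW.
have c0 : 0 < fine c by rewrite fine_gt0 // IH0 IHy.
have mS := measurable_volume_section (is_polyhedron_corner_simplex d.+1).
have mI (k l r : R) : measurable_fun [set: measurableTypeR R]
    (fun s => (k * \1_(`[l, r]%classic : set R) s)%:E).
  apply/measurable_EFinP; apply: measurable_funM; first exact: measurable_cst.
  by apply: measurable_indic; exact: measurable_itv.
split.
  pose h := `|\det (2%:M : 'M[R]_d)|^-1 * fine c.
  have h0 : 0 < h.
    by rewrite mulr_gt0 // invr_gt0 normr_gt0 det_scalar expf_neq0.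
  have hE : h%:E = volume (affine_preimage 2%:M 0 (@corner_simplex d)).
    rewrite scales_volume_unitmx ?EFinM -?cE //.
      by rewrite unitmxE det_scalar unitrX // unitfE.
    exact: is_polyhedron_corner_simplex.
  apply: (@lt_le_trans _ _ (h * (2^-1 - 0))%:E).
    by rewrite lte_fin mulr_gt0 // subr0 invr_gt0.
  rewrite -integral_const_itv ?invr_ge0 //; last exact: ltW.
  rewrite [leRHS]/=; apply: ge0_le_integral => //.
    by move=> s _; rewrite lee_fin mulr_ge0 // ltW.
  move=> s _; rewrite indicE; case: (boolP (s \in _)) => [/set_mem|_]; last first.
    by rewrite mulr0; exact: volume_ge0.
  rewrite /= in_itv /= mulr1 hE => /andP[s0 s1]; apply: le_volume.
  - exact/is_polyhedron_preimage/is_polyhedron_corner_simplex.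
  - exact/is_polyhedron_section/is_polyhedron_corner_simplex.
  move=> y; rewrite /affine_preimage /= addr0 mul_mx_scalar => -[y0 y1].
  apply/corner_simplex_section; split=> // [j|].
    by have := y0 j; rewrite mxE pmulr_rge0.
  move: y1; under eq_bigr do rewrite mxE; rewrite -mulr_sumr; lra.
apply: (@le_lt_trans _ _ (fine c * (1 - 0))%:E); last by rewrite ltry.
rewrite -integral_const_itv //; last exact: ltW.
rewrite [leLHS]/=; apply: ge0_le_integral => //.
  by move=> s _; exact: volume_ge0.
move=> s _; rewrite indicE; case: (boolP (s \in _)) => [_|/negP s01].
  rewrite mulr1 -cE; apply: le_volume.
  - exact/is_polyhedron_section/is_polyhedron_corner_simplex.
  - exact: is_polyhedron_corner_simplex.
  by move=> y /corner_simplex_section[s0 y0 y1]; split=> //; lra.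
rewrite mulr0 [X in volume X](_ : _ = set0) ?volume_set0 //.
apply/seteqP; split=> // y /corner_simplex_section[s0 y0 y1]; apply: s01.
apply/mem_set; rewrite /= in_itv /= s0 /=.
have : 0 <= \sum_j y 0 j by exact: sumr_ge0.
lra.
Qed.

Definition vertex_mx d (P : 'I_(1 + d) -> 'rV[R]_d) : 'M[R]_(1 + d) :=
  \matrix_i row_mx 1%:M (P i).

(** Subtracting the first vertex from the others turns the matrix of homogeneous
    coordinates into the linear map that sends the corner simplex to a
    translate of the given one. *)
Lemma volume_simplex d (P : 'I_(1 + d) -> 'rV[R]_d) :
  vertex_mx P \in unitmx ->
  volume [set y : 'rV[R]_d | exists w : 'rV[R]_(1 + d),
    (forall i, 0 <= w 0 i) /\ row_mx 1%:M y = w *m vertex_mx P]%classic =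
  (`|\det (vertex_mx P)|%:E * volume (@corner_simplex d))%E.
Proof.
set M := vertex_mx P => uM.
pose p := P (lshift d 0); pose D : 'M[R]_d := \matrix_i (P (rshift 1 i) - p).
have EM : M = block_mx (1%:M : 'M[R]_1) 0 (const_mx 1) 1%:M
    *m block_mx (1%:M : 'M[R]_1) p 0 D.
  rewrite mulmx_block !mul1mx !mul0mx !addr0 !mulmx1.
  rewrite /M /vertex_mx; apply/matrixP => i j; case: (split_ordP i) => i' ->;
  case: (split_ordP j) => j' ->;
  rewrite [LHS]mxE ?(block_mxEul, block_mxEur, block_mxEdl, block_mxEdr)
    ?(row_mxEl, row_mxEr) ?mxE ?ord1 //.
  by rewrite big_ord1 !mxE mul1r addrC subrK.
have dM : \det M = \det D.
  by rewrite EM det_mulmx det_lblock det_ublock !det1 !mul1r.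
have uD : D \in unitmx by rewrite unitmxE -dM -unitmxE.
have uD' : invmx D \in unitmx by rewrite unitmx_inv.
have := scales_volume_unitmx uD' (- (p *m invmx D)) (@is_polyhedron_corner_simplex d).
rewrite det_inv -dM normfV invrK => <-; congr volume.
have mulM (a : R) (z : 'rV[R]_d) : row_mx a%:M z *m M =
    row_mx (a + \sum_j z 0 j)%:M ((a + \sum_j z 0 j) *: p + z *m D).
  have zE : z *m const_mx 1 = (\sum_j z 0 j)%:M :> 'M[R]_1.
    apply/matrixP => i j; rewrite !mxE !ord1 mulr1n; apply: eq_bigr => k _.
    by rewrite mxE mulr1.
  rewrite EM mulmxA !mul_row_block !mulmx1 !mulmx0 !addr0 add0r zE -raddfD /=.
  by rewrite mul_scalar_mx.
apply/seteqP; split=> y; rewrite /affine_preimage /=.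
  move=> [w]; rewrite -(hsubmxK w) [lsubmx w]mx11_scalar mulM.
  set a := lsubmx w 0 0; set z := rsubmx w => -[w0] /eq_row_mx[a1 yE].
  have {}a1 : a + \sum_j z 0 j = 1 by have /matrixP/(_ 0 0) := a1; rewrite !mxE.
  have -> : y *m invmx D - p *m invmx D = z.
    by rewrite yE a1 scale1r mulmxDl mulmxK // addrC addKr.
  split=> [j|]; first by have := w0 (rshift 1 j); rewrite row_mxEr.
  by have := w0 (lshift d 0); rewrite row_mxEl mxE mulr1n -a1; lra.
rewrite -mulmxBl; set z := (y - p) *m _ => -[z0 z1].
exists (row_mx (1 - \sum_j z 0 j)%:M z); split=> [i|].
  case: (split_ordP i) => j ->; rewrite ?row_mxEl ?row_mxEr // mxE ord1 mulr1n.
  by rewrite subr_ge0.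
by rewrite mulM subrK scale1r /z mulmxKV // addrC subrK.
Qed.
End Volume.

(** * Affine functions and general position *)

Section Affine.
Variables (R : realType) (d : nat).
Implicit Types (g : 'rV[R]_d -> R).

Lemma affine_lincomb (I : finType) (P : pred I) g (w : I -> R) (p : I -> 'rV[R]_d) :
  affine g -> g (\sum_(i | P i) w i *: p i) =
     \sum_(i | P i) w i * g (p i) + (1 - \sum_(i | P i) w i) * g 0.
Proof.
move=> [a [b gE]]; rewrite !gE.
have dotS (q : I -> 'rV[R]_d) :
    dot a (\sum_(i | P i) w i *: q i) = \sum_(i | P i) w i * dot a (q i).
  rewrite /dot; under [RHS]eq_bigr do rewrite mulr_sumr.
  rewrite exchange_big; apply: eq_bigr => j _ /=.
  rewrite summxE mulr_sumr; apply: eq_bigr => i _; rewrite mxE; ring.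
have -> : dot a 0 = 0.
  by rewrite /dot big1 // => j _; rewrite mxE mulr0.
under [X in _ = X + _]eq_bigr do rewrite gE mulrDr.
rewrite dotS big_split /= -mulr_suml; ring.
Qed.

Lemma affine_conv g (e : R) (y p : 'rV[R]_d) : affine g ->
  g (y + e *: (p - y)) = g y + e * (g p - g y).
Proof.
move=> [a [b gE]]; rewrite !gE.
suff -> : dot a (y + e *: (p - y)) = dot a y + e * (dot a p - dot a y) by ring.
rewrite /dot -sumrB mulr_sumr -big_split /=; apply: eq_bigr => i _.
rewrite !mxE; ring.
Qed.

Lemma affine_sum (I : finType) (P : pred I) (w : I -> R)
    (g : I -> 'rV[R]_d -> R) :
  (forall i, affine (g i)) -> affine (fun y => \sum_(i | P i) w i * g i y).
Proof.
move=> /choice[a /choice[b gE]].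
exists (\sum_(i | P i) w i *: a i), (\sum_(i | P i) w i * b i) => y.
under eq_bigr do rewrite gE mulrDr.
rewrite big_split /=; congr (_ + _); rewrite /dot.
under [LHS]eq_bigr do rewrite mulr_sumr.
rewrite exchange_big; apply: eq_bigr => j _ /=.
rewrite summxE mulr_suml; apply: eq_bigr => i _; rewrite mxE; ring.
Qed.

End Affine.

(** A nonzero polynomial has finitely many roots, so some point of the moment
    curve, with a positive parameter, avoids any finite number of
    hyperplanes through the origin. *)
Lemma avoid_hyperplanes (R : realType) n (K : finType) (c : K -> 'I_n -> R) :
  (forall k, exists i, c k i != 0) ->
  exists w : 'I_n -> R, (forall i, 0 < w i) /\
    forall k, \sum_i c k i * w i != 0.
Proof.
move=> c0; pose p k : {poly R} := \sum_i c k i *: 'X^i.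
have p0 k : p k != 0.
  have [i ci] := c0 k; apply: contra ci => /eqP/polyP/(_ i).
  rewrite coef0 coef_sum (bigD1 i) //= coefZ coefXn eqxx mulr1.
  rewrite big1 ?addr0 => [/eqP|j ji] //.
  by rewrite coefZ coefXn eq_sym (inj_eq val_inj) (negbTE ji) mulr0.
(* A point of the moment curve lies on the hyperplane [k] when its parameter is
   a root of [p k]; one of the first [size q] positive integers is not a root
   of the product. *)
pose q := \prod_k p k.
have q0 : q != 0 by apply/prodf_neq0 => k _.
pose r := [seq j.+1%:R : R | j <- iota 0 (size q)].
have ur : uniq r.
  rewrite map_inj_uniq ?iota_uniq // => i j /eqP.
  by rewrite eqr_nat eqSS => /eqP.
have [qr|] := boolP (all (root q) r).
  by have := max_poly_roots q0 qr ur; rewrite size_map size_iota ltnn.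
move=> /allPn[_ /mapP[j _ ->] nr].
exists (fun i => j.+1%:R ^+ i); split=> [i|k]; first by rewrite exprn_gt0.
apply: contra nr => /eqP E; rewrite rootE horner_prod (bigD1 k) //=.
rewrite [(p k).[_]](_ : _ = 0) ?mul0r // -[RHS]E horner_sum.
by apply: eq_bigr => i _; rewrite hornerZ hornerXn.
Qed.

(** After a short enough step, finitely many affine functions of the step still
    have their initial signs if these are nonzero, and the nonconstant ones
    that start at 0 have left it. *)
Lemma small_step (R : realType) (K : finType) (a b : K -> R) :
  exists e : R, [/\ 0 < e, e < 1 & forall k,
    [/\ 0 < a k -> 0 < a k + e * b k, a k < 0 -> a k + e * b k < 0 &
        b k != 0 -> a k + e * b k != 0]].
Proof.
pose S := \sum_k `|b k| / `|a k|.
have S0 : 0 <= S by apply: sumr_ge0 => k _; rewrite divr_ge0.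
(* Each ratio `|b k| / `|a k| is at most [S], and is 0 by convention if
   [a k = 0]; adding 2 makes the step positive and less than 1. *)
exists (2 + S)^-1; split; first by rewrite invr_gt0; lra.
  by rewrite invf_lt1; lra.
move=> k; suff H : a k != 0 -> `|(2 + S)^-1 * b k| < `|a k|.
  have pos : 0 < a k -> 0 < a k + (2 + S)^-1 * b k.
    move=> ak; have := H (lt0r_neq0 ak).
    by rewrite (gtr0_norm ak) ltr_norml => /andP[]; lra.
  have neg : a k < 0 -> a k + (2 + S)^-1 * b k < 0.
    move=> ak; have := H (ltr0_neq0 ak).
    by rewrite (ltr0_norm ak) ltr_norml => /andP[]; lra.
  split=> // bk; case: (ltgtP (a k) 0) pos neg => [ak|ak|->] pos neg.
  - by rewrite lt_eqF // neg.
  - by rewrite gt_eqF // pos.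
  - by rewrite add0r mulf_neq0 // invr_neq0 // gt_eqF //; lra.
move=> ak; rewrite normrM gtr0_norm ?invr_gt0; last by lra.
rewrite mulrC ltr_pdivrMr; last by lra.
have kS : `|b k| / `|a k| <= S.
  by rewrite /S (bigD1 k) //= lerDl sumr_ge0 // => j _; rewrite divr_ge0.
have : 0 < `|a k| by rewrite normr_gt0.
move=> ak0; rewrite ler_pdivrMr // in kS; nra.
Qed.

(** * Barycentric coordinates and interpolation of heights *)

Section Barycentric.
Variables (R : realType) (d n : nat) (x : 'I_n -> 'rV[R]_d).
Hypothesis x_gp : forall A : {set 'I_n}, #|A| = d.+1 -> ~ on_hyperplane x A.
Implicit Types (s f A T : {set 'I_n}) (h w : 'I_n -> R) (y : 'rV[R]_d).

Definition homog y : 'rV[R]_(1 + d) := row_mx 1%:M y.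

Lemma sum_homog A w : \sum_(i in A) w i *: homog (x i) =
  row_mx (\sum_(i in A) w i)%:M (\sum_(i in A) w i *: x i).
Proof.
elim/big_rec3: _ => [|i a v u _ ->]; first by rewrite raddf0 row_mx0.
by rewrite scale_row_mx add_row_mx scale_scalar_mx mulr1 raddfD.
Qed.

(** Homogeneous coordinates turn affine dependence into linear dependence. *)
Definition homog_mx s : 'M[R]_(#|s|, 1 + d) :=
  \matrix_(k < #|s|) homog (x (enum_val k)).

Lemma mul_homog_mx s (w : 'rV[R]_#|s|) :
  w *m homog_mx s = \sum_k w 0 k *: homog (x (enum_val k)).
Proof. by rewrite mulmx_sum_row; apply: eq_bigr => k _; rewrite rowK. Qed.

(** A vector in the right kernel is the equation of a hyperplane through the
    points. *)
Lemma homog_mx_full s : #|s| = d.+1 -> row_full (homog_mx s).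
Proof.
move=> sd; apply: contra_notT (x_gp sd) => nfull.
have [v v0 Nv] : exists2 v : 'cV[R]_(1 + d), v != 0 & homog_mx s *m v = 0.
  have /matrix0Pn[i [j Cij]] : cokermx (homog_mx s) != 0.
    rewrite -mxrank_eq0 mxrank_coker subn_eq0 -ltnNge.
    by rewrite ltn_neqAle rank_leq_col andbT.
  exists (col j (cokermx (homog_mx s))).
    by apply/matrix0Pn; exists i, 0; rewrite mxE.
  by rewrite colE mulmxA mulmx_coker mul0mx.
pose a := (dsubmx v)^T; pose b := usubmx v 0 0.
have dotE i : i \in s -> b + dot a (x i) = 0.
  move=> si; have /matrixP/(_ (enum_rank_in si i) 0) := Nv.
  rewrite mxE big_split_ord /= big_ord1 [homog_mx _ _ _]mxE row_mxEl.
  rewrite !mxE mulr1n mul1r /b mxE => <-; congr (_ + _).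
  apply: eq_bigr => l _.
  by rewrite [homog_mx _ _ _]mxE row_mxEr enum_rankK_in // !mxE mulrC.
exists a, (- b); split=> [|i si]; last by have := dotE i si; lra.
apply: contra v0 => /eqP a0.
have /card_gt0P[i si] : (0 < #|s|)%N by rewrite sd.
have b0 : b = 0.
  have := dotE i si; rewrite a0 /dot big1 ?addr0 // => j _.
  by rewrite mxE mul0r.
rewrite -(vsubmxK v) [usubmx v]mx11_scalar -/b b0 -(trmxK (dsubmx v)) -/a a0.
by rewrite raddf0 trmx0 col_mx0.
Qed.

Lemma simplex_independent s : #|s| = d.+1 -> affinely_independent x s.
Proof.
move=> sd w w0 wx0 i si.
have free : row_free (homog_mx s).
  by rewrite -row_leq_rank (eqP (homog_mx_full sd)) sd.
have : (\row_k w (enum_val k)) *m homog_mx s = 0.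
  rewrite mul_homog_mx; under eq_bigr do rewrite mxE.
  rewrite -(big_enum_val (fun i => w i *: homog (x i))) sum_homog w0 wx0.
  by rewrite raddf0 row_mx0.
move/eqP; rewrite mulmx_free_eq0 // => /eqP/rowP/(_ (enum_rank_in si i)).
by rewrite !mxE enum_rankK_in.
Qed.

Definition bary s i y : R :=
  \sum_(k < #|s|) (enum_val k == i)%:R * (homog y *m pinvmx (homog_mx s)) 0 k.

Lemma bary_notin s i y : i \notin s -> bary s i y = 0.
Proof.
move=> si; apply: big1 => k _; case: eqP => [ki|]; last by rewrite mul0r.
by rewrite -ki enum_valP in si.
Qed.

Lemma sum_bary_homog s y : #|s| = d.+1 ->
  \sum_(i in s) bary s i y *: homog (x i) = homog y.
Proof.
move=> sd.
have <- := mulmxKpV (submx_full (homog y) (homog_mx_full sd)).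
rewrite mul_homog_mx big_enum_val /=; apply: eq_bigr => k _; congr (_ *: _).
rewrite /bary (bigD1 k) //= eqxx mul1r big1 ?addr0 // => l lk.
by rewrite (inj_eq enum_val_inj) (negbTE lk) mul0r.
Qed.

Lemma sum_bary s y : #|s| = d.+1 -> \sum_(i in s) bary s i y = 1.
Proof.
move=> sd; have := sum_bary_homog y sd; rewrite sum_homog /homog.
by move=> /eq_row_mx[/matrixP/(_ 0 0) + _]; rewrite !mxE.
Qed.

Lemma sum_bary_x s y : #|s| = d.+1 -> \sum_(i in s) bary s i y *: x i = y.
Proof.
move=> sd; have := sum_bary_homog y sd; rewrite sum_homog /homog.
by move=> /eq_row_mx[].
Qed.

Lemma bary_unique s w y i : #|s| = d.+1 -> \sum_(k in s) w k = 1 ->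
  \sum_(k in s) w k *: x k = y -> i \in s -> bary s i y = w i.
Proof.
move=> sd w1 wy si; apply/eqP; rewrite -subr_eq0; apply/eqP.
apply: (simplex_independent sd (w := fun k => bary s k y - w k)) si.
  by rewrite sumrB sum_bary // w1 subrr.
under eq_bigr do rewrite scalerBl.
by rewrite sumrB sum_bary_x // wy subrr.
Qed.

Lemma bary_vertex s i k : #|s| = d.+1 -> k \in s -> bary s i (x k) = (i == k)%:R.
Proof.
move=> sd sk; case: (boolP (i \in s)) => si; last first.
  by rewrite bary_notin //; case: eqP => // ik; rewrite ik sk in si.
apply: (bary_unique (w := fun i => (i == k)%:R)) => //.
  rewrite (bigD1 k) //= eqxx big1 ?addr0 // => j /andP[_ /negbTE ->] //.
rewrite (bigD1 k) //= eqxx scale1r big1 ?addr0 // => j /andP[_ /negbTE ->].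
by rewrite scale0r.
Qed.

Lemma affine_bary s i : affine (bary s i).
Proof.
apply: affine_sum => k.
set M := pinvmx _; exists (\row_j M (rshift 1 j) k), (M (lshift d 0) k) => y.
rewrite mxE big_split_ord /= big_ord1 row_mxEl mxE mulr1n mul1r addrC.
congr (_ + _); apply: eq_bigr => j _; rewrite row_mxEr mxE; ring.
Qed.

Lemma hullP s y : #|s| = d.+1 ->
  hull x s y <-> forall i, i \in s -> 0 <= bary s i y.
Proof.
move=> sd; split=> [[w [w0 w1 ->]] i si|H].
  by rewrite (bary_unique sd w1 erefl si); exact: w0.
by exists (bary s ^~ y); rewrite sum_bary // sum_bary_x.
Qed.

Definition interp s h y : R := \sum_(i in s) h i * bary s i y.

Lemma affine_interp s h : affine (interp s h).
Proof. by apply: affine_sum => i; exact: affine_bary. Qed.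

Lemma interp_vertex s h i : #|s| = d.+1 -> i \in s -> interp s h (x i) = h i.
Proof.
move=> sd si; rewrite /interp (bigD1 i) //= bary_vertex // eqxx mulr1.
rewrite big1 ?addr0 // => j /andP[sj /negbTE ji].
by rewrite bary_vertex // ji mulr0.
Qed.

Lemma affine_eq_interp s g h y : #|s| = d.+1 -> affine g ->
  (forall i, i \in s -> g (x i) = h i) -> g y = interp s h y.
Proof.
move=> sd ag gh; rewrite -{1}(sum_bary_x y sd) affine_lincomb //.
rewrite sum_bary // subrr mul0r addr0; apply: eq_bigr => i si.
by rewrite gh // mulrC.
Qed.

(** The height of the lifted point [j] above the affine interpolation on
    [s]. *)
Definition excess s h j : R := h j - interp s h (x j).

End Barycentric.

(** * Convex hulls and circuits *)

Section Circuits.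
Variables (R : realType) (d n : nat) (x : 'I_n -> 'rV[R]_d).
Hypothesis x_gp : forall A : {set 'I_n}, #|A| = d.+1 -> ~ on_hyperplane x A.
Implicit Types (s f A B T : {set 'I_n}) (h w : 'I_n -> R) (y : 'rV[R]_d).

Lemma sum_supported (V : nmodType) A (F : 'I_n -> V) :
  (forall i, i \notin A -> F i = 0) -> \sum_(i in A) F i = \sum_i F i.
Proof. by move=> F0; rewrite [RHS](bigID (mem A)) /= [X in _ + X]big1 ?addr0. Qed.

Lemma hull_weightsP A y : hull x A y <->
  exists w, [/\ forall i, 0 <= w i, forall i, i \notin A -> w i = 0,
                \sum_i w i = 1 & y = \sum_i w i *: x i].
Proof.
split=> [[w [w0 w1 ->]]|[w [w0 wA w1 ->]]].
  exists (fun i => if i \in A then w i else 0); split=> [i|i||].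
  - by case: ifP => // /w0.
  - by move/negbTE => ->.
  - by rewrite -big_mkcond.
  - rewrite big_mkcond; apply: eq_bigr => i _.
    by case: ifP; rewrite ?scale0r.
exists w; split=> //; first by rewrite sum_supported.
by rewrite sum_supported // => i iA; rewrite wA ?scale0r.
Qed.

Lemma hullS A B y : A \subset B -> hull x A y -> hull x B y.
Proof.
move=> /fintype.subsetP AB /hull_weightsP[w [w0 wA w1 wy]].
apply/hull_weightsP; exists w; split=> // i iB; apply: wA.
by apply: contra iB => /AB.
Qed.

Lemma hull_conv A y z (e : R) : 0 <= e <= 1 -> hull x A y -> hull x A z ->
  hull x A (y + e *: (z - y)).
Proof.
move=> /andP[e0 e1] /hull_weightsP[v [v0 vA v1 ->]] /hull_weightsP[w [w0 wA w1 ->]].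
apply/hull_weightsP; exists (fun i => v i + e * (w i - v i)); split=> [i|i iA||].
- by have := v0 i; have := w0 i; nra.
- by rewrite vA // wA // subrr mulr0 addr0.
- by rewrite big_split /= -mulr_sumr sumrB v1 w1 subrr mulr0 addr0.
- rewrite -sumrB scaler_sumr -big_split; apply: eq_bigr => i _ /=.
  by rewrite scalerDl -scalerA scalerBl.
Qed.

Lemma hull1 i : hull x [set i] (x i).
Proof.
exists (fun=> 1); split=> //; rewrite ?big_set1 ?scale1r //.
Qed.

Lemma hull0 y : ~ hull x finset.set0 y.
Proof. by move=> [w [_]]; rewrite big_set0 => /eqP; rewrite eq_sym oner_eq0. Qed.

Definition circuit s j i : R := (i == j)%:R - bary x s i (x j).

Lemma circuit_apex s j : j \notin s -> circuit s j j = 1.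
Proof. by move=> js; rewrite /circuit eqxx bary_notin // subr0. Qed.

Lemma circuit_notin s j i : i \notin j |: s -> circuit s j i = 0.
Proof.
by rewrite !inE negb_or /circuit => /andP[/negbTE -> /bary_notin ->]; rewrite subrr.
Qed.

Lemma sum_pred1 (V : lmodType R) j (F : 'I_n -> V) :
  \sum_i (i == j)%:R *: F i = F j.
Proof.
rewrite (bigD1 j) //= eqxx scale1r big1 ?addr0 // => i /negbTE ->.
by rewrite scale0r.
Qed.

Lemma sum_circuit s j : #|s| = d.+1 -> \sum_i circuit s j i = 0.
Proof.
move=> sd; rewrite sumrB -(@sum_supported _ s (fun i => bary x s i (x j))).
  rewrite (sum_bary x_gp) //; have := @sum_pred1 R^o j (fun=> 1).
  rewrite /GRing.scale /=; under eq_bigr do rewrite mulr1.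
  by move=> ->; rewrite subrr.
by move=> i /bary_notin ->.
Qed.

Lemma sum_circuit_x s j : #|s| = d.+1 -> \sum_i circuit s j i *: x i = 0.
Proof.
move=> sd; under eq_bigr do rewrite scalerBl.
rewrite sumrB sum_pred1 -(@sum_supported _ s (fun i => bary x s i (x j) *: x i)).
  by rewrite (sum_bary_x x_gp) // subrr.
by move=> i /bary_notin ->; rewrite scale0r.
Qed.

Lemma excessE s h j : excess x s h j = \sum_i circuit s j i * h i.
Proof.
under eq_bigr do rewrite mulrBl; rewrite sumrB.
have := @sum_pred1 R^o j h; rewrite /GRing.scale /= => ->; congr (_ - _).
rewrite /interp sum_supported => [|i /bary_notin ->]; last by rewrite mulr0.
by apply: eq_bigr => i _; rewrite mulrC.
Qed.

Lemma excess_vertex s h i : #|s| = d.+1 -> i \in s -> excess x s h i = 0.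
Proof. by move=> sd si; rewrite /excess interp_vertex // subrr. Qed.

Lemma excess_lin s h h' (e : R) j :
  excess x s (fun i => h i + e * h' i) j = excess x s h j + e * excess x s h' j.
Proof.
rewrite !excessE mulr_sumr -big_split; apply: eq_bigr => i _ /=; ring.
Qed.

(** Subtracting the interpolation on [s] from the heights leaves both sides
    unchanged, and afterwards only the height of the point [i] is nonzero. *)
Lemma dependence_excess s (l : 'I_n -> R) i h : #|s| = d.+1 ->
  (forall k, k \notin i |: s -> l k = 0) ->
  \sum_k l k = 0 -> \sum_k l k *: x k = 0 ->
  \sum_k l k * h k = l i * excess x s h i.
Proof.
move=> sd lT l0 lx.
have : \sum_k l k * interp x s h (x k) = 0.
  have := affine_lincomb predT l x (affine_interp x s h).
  rewrite lx l0 subr0 mul1r => /eqP; rewrite -subr_eq0 opprD addrCA addrN addr0.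
  by rewrite oppr_eq0 => /eqP.
move=> H; rewrite -[LHS]subr0 -[X in _ - X]H -sumrB.
rewrite (bigD1 i) //= big1 ?addr0; first by rewrite -mulrBr.
move=> k ki; have [ks|ks] := boolP (k \in s).
  by rewrite interp_vertex // subrr.
by rewrite lT ?mul0r ?subrr // !inE negb_or ki.
Qed.

Lemma card_exchange s i j : #|s| = d.+1 -> j \notin s -> i \in j |: s ->
  #|(j |: s) :\ i| = d.+1.
Proof.
move=> sd js iT; have := cardsD1 i (j |: s).
by rewrite iT cardsU1 js sd !add1n => -[].
Qed.

(** All the affine dependences on the circuit [j |: s] are proportional, so the
    signs of the excesses over its [d+2] simplices are determined by any one of
    them. *)
Lemma excess_exchange s h i j : #|s| = d.+1 -> j \notin s -> i \in j |: s ->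
  excess x s h j = circuit s j i * excess x ((j |: s) :\ i) h i.
Proof.
move=> sd js iT; rewrite excessE.
apply: dependence_excess; rewrite ?finset.setD1K //.
- exact: card_exchange.
- exact: circuit_notin.
- exact: sum_circuit.
- exact: sum_circuit_x.
Qed.

(** Otherwise the excess over [s] would not depend on the height of [x j]. *)
Lemma circuit_neq0 s i j : #|s| = d.+1 -> j \notin s -> i \in j |: s ->
  circuit s j i != 0.
Proof.
move=> sd js iT; have := excess_exchange (fun k => (k == j)%:R) sd js iT.
rewrite excessE (bigD1 j) //= circuit_apex // eqxx mulr1 big1 ?addr0.
  by move=> H; apply/negP => /eqP E; move: H; rewrite E mul0r => /eqP; rewrite oner_eq0.
by move=> k /negbTE ->; rewrite mulr0.
Qed.

(** The ratio test of the simplex method: weights can be moved along a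
    dependence until the first of them vanishes. *)
Lemma weight_exchange A w (l : 'I_n -> R) : (forall i, i \in A -> 0 <= w i) ->
  (exists2 i, i \in A & 0 < l i) ->
  exists i (th : R), [/\ i \in A, 0 < l i, w i = th * l i
                  & forall k, k \in A -> th * l k <= w k].
Proof.
move=> w0 [i1 i1A l1]; pose P i := (i \in A) && (0 < l i).
have P1 : P i1 by rewrite /P i1A.
case: (@Order.TotalTheory.arg_minP _ _ _ i1 P (fun i => w i / l i) P1).
move=> i /andP[iA li] imin; exists i, (w i / l i); split=> //.
  by rewrite divfK // gt_eqF.
move=> k kA; have [lk|lk] := ltP 0 (l k).
  by rewrite -ler_pdivlMr //; apply: imin; rewrite /P kA.
by apply: le_trans (w0 _ kA); rewrite mulr_ge0_le0 // divr_ge0 ?w0 // ltW.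
Qed.

Lemma exists_subset A k : (k <= #|A|)%N -> exists2 s : {set 'I_n}, s \subset A & #|s| = k.
Proof.
move=> kA; exists (finset (mem (take k (enum A)))).
  by apply/fintype.subsetP => i; rewrite inE => /mem_take; rewrite mem_enum.
rewrite cardsE (card_uniqP (take_uniq k (enum_uniq A))) size_takel // -cardE //.
Qed.

Lemma Caratheodory A y : (d < #|A|)%N -> hull x A y ->
  exists s, [/\ s \subset A, #|s| = d.+1 & hull x s y].
Proof.
have [m] := ubnP #|A|; elim: m A => // m IH A Am dA yA.
have [Ad|Ad] := eqVneq #|A| d.+1; first by exists A.
have [s sA sd] := exists_subset dA.
have [j jA js] : exists2 j, j \in A & j \notin s.
  apply/fintype.subsetPn; apply: contra Ad => As.
  by rewrite -sd; apply/eqP/eq_card/finset.setP/eqP; rewrite finset.eqEsubset As.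
have [w [w0 wA w1 wy]] := (hull_weightsP A y).1 yA.
have [i [th [iA li wi thl]]] := @weight_exchange A w (circuit s j) (fun i _ => w0 i)
  (ex_intro2 _ _ j jA (eq_ind_r (fun c => 0 < c) ltr01 (circuit_apex js))).
have cA k : k \notin A -> circuit s j k = 0.
  move=> kA; apply: circuit_notin; apply: contra kA.
  by case/finset.setU1P => [->//|]; exact: (fintype.subsetP sA).
have yi : hull x (A :\ i) y.
  apply/hull_weightsP; exists (fun k => w k - th * circuit s j k); split=> [k|k||].
  - have [kA|kA] := boolP (k \in A); first by rewrite subr_ge0 thl.
    by rewrite cA // mulr0 subr0.
  - rewrite !inE negb_and negbK => /orP[/eqP->|kA]; first by rewrite wi subrr.
    by rewrite cA // mulr0 subr0 wA.
  - by rewrite sumrB w1 -mulr_sumr sum_circuit // mulr0 subr0.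
  - under eq_bigr do rewrite scalerBl -scalerA.
    by rewrite sumrB -scaler_sumr sum_circuit_x // scaler0 subr0.
have cAi : #|A :\ i| = #|A|.-1 by rewrite (cardsD1 i A) iA.
have Ad1 : (d.+1 < #|A|)%N by rewrite ltn_neqAle eq_sym Ad dA.
have [||//|s' [s'A s'd ys']] := IH (A :\ i).
- by rewrite cAi; case: #|A| Am Ad1.
- by rewrite cAi; case: #|A| Ad1.
exists s'; split=> //.
exact: fintype.subset_trans s'A (finset.subsetDl _ _).
Qed.

End Circuits.

(** * The lower hull of generic heights is a triangulation *)

Section LowerHull.
Variables (R : realType) (d n : nat) (x : 'I_n -> 'rV[R]_d).
Hypothesis x_gp : forall A : {set 'I_n}, #|A| = d.+1 -> ~ on_hyperplane x A.
Implicit Types (s f A B T : {set 'I_n}) (h w : 'I_n -> R) (y p : 'rV[R]_d).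

(** Each barycentric coordinate that must not vanish is a nonzero linear
    functional of the weights of the point. *)
Lemma generic_point s0 : #|s0| = d.+1 ->
  exists p, (forall i, i \in s0 -> 0 < bary x s0 i p) /\
    forall s i, #|s| = d.+1 -> i \in s -> bary x s i p != 0.
Proof.
move=> s0d; have /card_gt0P[i0 si0] : (0 < #|s0|)%N by rewrite s0d.
(* For pairs that are not a simplex and one of its vertices, the functional is
   set to a nonzero constant. *)
pose c (si : {set 'I_n} * 'I_n) k : R :=
  if (#|si.1| == d.+1) && (si.2 \in si.1) then
    if k \in s0 then bary x si.1 si.2 (x k) else 0
  else 1.
have c0 si : exists k, c si k != 0.
  rewrite /c.
  have [/andP[/eqP sd si2]|_] := boolP ((#|si.1| == d.+1) && (si.2 \in si.1)); last first.
    by exists i0; rewrite oner_neq0.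
  apply: contrapT => H; have := bary_vertex x_gp si.2 sd si2.
  rewrite eqxx (affine_eq_interp x_gp (h := fun=> 0) (x si.2) s0d
    (affine_bary _ _ _)) => [|k sk].
    by rewrite /interp big1 => [/eqP|k _]; rewrite ?mul0r // eq_sym oner_eq0.
  by apply/eqP/negP => /negP bk; apply: H; exists k; rewrite sk.
have [w [w0 wc]] := avoid_hyperplanes c0.
pose Z := \sum_(k in s0) w k.
have Z0 : 0 < Z by rewrite /Z (bigD1 i0) //= ltr_pwDl // sumr_ge0 // => k _; exact: ltW.
have Z1 : \sum_(k in s0) w k / Z = 1 by rewrite -mulr_suml divff // gt_eqF.
exists (\sum_(k in s0) (w k / Z) *: x k); split=> [i si|s i sd si].
  rewrite (bary_unique x_gp (w := fun k => w k / Z) s0d Z1 erefl si).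
  by rewrite divr_gt0.
rewrite affine_lincomb; last exact: affine_bary.
rewrite Z1 subrr mul0r addr0.
have := wc (s, i); rewrite /c /= sd eqxx si /=; apply: contra => /eqP E.
rewrite [X in X == _](_ : _ = Z * \sum_(k in s0) w k / Z * bary x s i (x k)).
  by rewrite E mulr0.
rewrite mulr_sumr [RHS]big_mkcond; apply: eq_bigr => k _.
by case: ifP => _; rewrite ?mul0r //; field; rewrite gt_eqF.
Qed.

Lemma bary_interior_hull s y : #|s| = d.+1 ->
  (forall i, i \in s -> 0 < bary x s i y) -> hull x s y.
Proof. by move=> sd H; apply/(hullP x_gp) => // i /H/ltW. Qed.

(** A small move towards a generic point of [s0] puts [y] in generic
    position, and the only open simplices it can enter are those whose
    closure contains [y]. *)
Lemma generic_approach s0 y : #|s0| = d.+1 ->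
  exists (p : 'rV[R]_d) (e : R), [/\ hull x s0 p, 0 < e < 1 &
    forall s i, #|s| = d.+1 -> i \in s ->
      [/\ bary x s i (y + e *: (p - y)) != 0,
        0 < bary x s i y -> 0 < bary x s i (y + e *: (p - y)) &
        0 < bary x s i (y + e *: (p - y)) -> 0 <= bary x s i y]].
Proof.
move=> s0d; have [p [p0 pgen]] := generic_point s0d.
have [e [e0 e1 eS]] := small_step
  (fun si : {set 'I_n} * 'I_n => bary x si.1 si.2 y)
  (fun si => bary x si.1 si.2 p - bary x si.1 si.2 y).
exists p, e; split=> //; first exact: bary_interior_hull.
  by rewrite e0.
move=> s i sd si; rewrite affine_conv; last exact: affine_bary.
have /= [] := eS (s, i); have := pgen s i sd si.
case: (ltgtP 0 (bary x s i y)) => [b0|b0|<-] pne H1 H2 _; split=> //.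
- by have := H1 isT; rewrite lt0r => /andP[].
- by have := H2 isT; rewrite lt_neqAle => /andP[].
- by move=> H3; have := lt_trans H3 (H2 isT); rewrite ltxx.
- by rewrite add0r subr0 mulf_neq0 // gt_eqF.
Qed.

Definition generic h := forall s j, #|s| = d.+1 -> j \notin s -> excess x s h j != 0.

Definition lower_cells A h : {set {set 'I_n}} :=
  [set s : {set 'I_n} | [&& s \subset A, #|s| == d.+1 &
     [forall j in A :\: s, 0 < excess x s h j]]]%SET.

(** Taking the faces of the full cells, instead of the contact sets of all
    supporting affine functions, makes the complex depend on the signs of the
    excesses alone. *)
Definition lower_hull A h : {set {set 'I_n}} :=
  [set f : {set 'I_n} | [exists s in lower_cells A h, f \subset s]]%SET.

Lemma lower_cellsP A h s : reflect
  [/\ s \subset A, #|s| = d.+1 & forall j, j \in A -> j \notin s -> 0 < excess x s h j]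
  (s \in lower_cells A h).
Proof.
rewrite inE; apply: (iffP and3P) => -[sA sd].
  by move: sd => /eqP sd /forall_inP H; split=> // j jA js; apply: H; rewrite inE js.
move=> H; split=> //; first by apply/eqP.
by apply/forall_inP => j; rewrite inE => /andP[js jA]; exact: H.
Qed.

Lemma lower_hullP A h f : reflect (exists2 s, s \in lower_cells A h & f \subset s)
  (f \in lower_hull A h).
Proof. by rewrite inE; exact: exists_inP. Qed.

Lemma excess_ge0 A h s j : s \in lower_cells A h -> j \in A -> 0 <= excess x s h j.
Proof.
move=> /lower_cellsP[sA sd sex] jA.
have [js|js] := boolP (j \in s); first by rewrite (excess_vertex x_gp).
exact/ltW/sex.
Qed.

Lemma maximal_lower_hull A h : maximal_cells d (lower_hull A h) = lower_cells A h.
Proof.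
apply/finset.setP => s; rewrite inE; apply/andP/idP.
  move=> [/lower_hullP[s' s'c ss'] /eqP sd].
  have /lower_cellsP[_ s'd _] := s'c.
  suff -> : s = s' by [].
  by apply/eqP; rewrite eqEcard ss' sd s'd leqnn.
move=> sc; split; last by have /lower_cellsP[_ -> _] := sc.
by apply/lower_hullP; exists s.
Qed.

(** For a generic [y'] near [y], take among the simplices that contain
    [y'] one whose interpolation is lowest at [y'].  If a point were lifted below
    it, exchanging that point for a vertex as in the simplex method would
    give a lower value. *)
Lemma lower_hull_cover A h y : generic h -> (d < #|A|)%N -> hull x A y ->
  exists2 s, s \in lower_cells A h & hull x s y.
Proof.
move=> hgen dA yA; have [s0 s0A s0d] := exists_subset dA.
have [p [e [ps0 /andP[e0 e1] gen]]] := generic_approach y s0d.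
set y' := y + _ in gen.
have y'A : hull x A y'.
  by apply: hull_conv => //; [rewrite !ltW|exact: hullS ps0].
have [s1 [s1A s1d y's1]] := Caratheodory x_gp dA y'A.
pose P (s : {set 'I_n}) := [&& s \subset A, #|s| == d.+1 &
  [forall i in s, 0 <= bary x s i y']].
have P1 : P s1.
  by apply/and3P; split=> //; [apply/eqP|apply/forall_inP; exact/(hullP x_gp)].
case: (@Order.TotalTheory.arg_minP _ _ _ s1 P (fun s => interp x s h y') P1).
move=> s /and3P[sA /eqP sd /forall_inP sy'] smin.
have s0' i : i \in s -> 0 < bary x s i y'.
  by move=> si; rewrite lt0r sy' // andbT; case: (gen s i sd si).
exists s; last first.
  apply/(hullP x_gp) => // i si; have [_ _] := gen s i sd si; apply; exact: s0'.
apply/lower_cellsP; split=> // j jA js; rewrite lt0r hgen //= leNgt.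
apply/negP => ex_lt0.
(* The coefficients of the circuit sum to 0 and that of [j] is 1, so another is
   negative: the weight of [j] can be increased until a vertex [i] of [s] leaves. *)
have [k ks ck] : exists2 k, k \in j |: s & 0 < - circuit x s j k.
  apply: contrapT => H; have := sum_circuit x_gp j sd.
  rewrite (bigD1 j) //= circuit_apex // => /eqP.
  rewrite gt_eqF // ltr_pwDl // sumr_ge0 // => k kj.
  have [kT|kT] := boolP (k \in j |: s); last by rewrite circuit_notin.
  by rewrite leNgt -oppr_gt0; apply/negP => ck; apply: H; exists k.
have [||i [th [iT ci wi thl]]] := @weight_exchange R n (j |: s)
    (fun i => bary x s i y') (fun i => - circuit x s j i).
- move=> i /finset.setU1P[->|]; first by rewrite bary_notin.
  exact: sy'.
- by exists k.
have is_ : i \in s.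
  case/finset.setU1P: iT ci => // ->; rewrite circuit_apex // => H.
  by have := lt_trans H (ltrN10 R); rewrite ltxx.
have th0 : 0 < th by have := s0' _ is_; rewrite wi pmulr_lgt0.
have s'd : #|(j |: s) :\ i| = d.+1 by apply: card_exchange.
set s' := _ :\ i in s'd.
clear k ks ck.
pose w k := bary x s k y' + th * circuit x s j k.
have w0 k : k \notin s' -> w k = 0.
  rewrite in_setD1 negb_and negbK => /orP[/eqP->|kT].
    by rewrite /w wi mulrN addNr.
  rewrite /w circuit_notin // mulr0 addr0 bary_notin //.
  by apply: contra kT => ks; rewrite inE ks orbT.
have w1 : \sum_(k in s') w k = 1.
  rewrite sum_supported // big_split -mulr_sumr sum_circuit // mulr0.
  rewrite Monoid.mulm1 -(@sum_supported _ _ s); last by move=> l ls; exact: bary_notin.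
  exact: sum_bary.
have wy : \sum_(k in s') w k *: x k = y'.
  rewrite sum_supported; last by move=> l /w0 ->; rewrite scale0r.
  under eq_bigr do rewrite scalerDl -scalerA.
  rewrite big_split -scaler_sumr sum_circuit_x // scaler0 Monoid.mulm1.
  rewrite -(@sum_supported _ _ s); last by move=> l /bary_notin ->; rewrite scale0r.
  exact: sum_bary_x.
have Ps' : P s'.
  apply/and3P; split; last 1 first.
  - apply/forall_inP => l ls'; rewrite (bary_unique x_gp s'd w1 wy) // /w.
    have lT : l \in j |: s by move: ls'; rewrite in_setD1 => /andP[].
    by have := thl l lT; rewrite mulrN; lra.
  - apply/fintype.subsetP => l; rewrite !inE => /andP[_ /orP[/eqP->//|]].
    exact: (fintype.subsetP sA).
  - by apply/eqP.
have := smin _ Ps'; rewrite leNgt => /negP; apply.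
suff -> : interp x s' h y' = interp x s h y' + th * excess x s h j.
  by rewrite gtrDl pmulr_rlt0.
rewrite /interp; under eq_bigr => l ls' do rewrite (bary_unique x_gp s'd w1 wy ls').
rewrite sum_supported; last by move=> l /w0 ->; rewrite mulr0.
rewrite sum_supported; last by move=> l /bary_notin ->; rewrite mulr0.
rewrite excessE mulr_sumr -big_split; apply: eq_bigr => l _ /=; rewrite /w; ring.
Qed.

(** Write [y] as a convex combination of vertices of [f1] and of [f2].  The
    interpolation on [s1] is below all heights on [A] and agrees with them on [f1], so
    the first combination has average height at most that of the second;
    by symmetry the averages agree, which forces the second combination to be
    supported in [s1], where barycentric coordinates are unique. *)
Lemma lower_hull_inter A h s1 s2 f1 f2 y :
  s1 \in lower_cells A h -> s2 \in lower_cells A h ->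
  f1 \subset s1 -> f2 \subset s2 -> hull x f1 y -> hull x f2 y ->
  hull x (f1 :&: f2)%SET y.
Proof.
move=> s1c s2c fs1 fs2 /hull_weightsP[w [w0 wf w1 wy]] /hull_weightsP[v [v0 vf v1 vy]].
have /lower_cellsP[s1A s1d s1ex] := s1c; have /lower_cellsP[s2A s2d _] := s2c.
(* The average height exceeds the interpolation at the average point by the
   average excess. *)
have gap s (u : 'I_n -> R) : \sum_i u i = 1 -> y = \sum_i u i *: x i ->
    \sum_i u i * h i = interp x s h y + \sum_i u i * excess x s h i.
  move=> u1 ->; rewrite affine_lincomb; last exact: affine_interp.
  rewrite u1 subrr mul0r addr0 -big_split; apply: eq_bigr => i _ /=.
  by rewrite /excess; ring.
have ex0 s s' f u : s \in lower_cells A h -> s' \in lower_cells A h ->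
    f \subset s' -> (forall i, 0 <= u i) -> (forall i, i \notin f -> u i = 0) ->
    forall i, 0 <= u i * excess x s h i.
  move=> sc /lower_cellsP[s'A _ _] fs' u0 uf i.
  have [fi|/uf->] := boolP (i \in f); last by rewrite mul0r.
  rewrite mulr_ge0 //; apply: excess_ge0 sc _.
  exact/(fintype.subsetP s'A)/(fintype.subsetP fs').
have on_cell s f u : s \in lower_cells A h -> f \subset s ->
    (forall i, i \notin f -> u i = 0) -> \sum_i u i * excess x s h i = 0.
  move=> /lower_cellsP[_ sd _] fs uf; apply: big1 => i _.
  have [fi|/uf->] := boolP (i \in f); last by rewrite mul0r.
  by rewrite excess_vertex ?mulr0 //; exact: (fintype.subsetP fs).
have g11 := gap s1 w w1 wy; have g12 := gap s1 v v1 vy.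
have g21 := gap s2 w w1 wy; have g22 := gap s2 v v1 vy.
rewrite (on_cell s1 f1) // addr0 in g11; rewrite (on_cell s2 f2) // addr0 in g22.
have v_ex := ex0 s1 s2 f2 v s1c s2c fs2 v0 vf.
have w_ex := ex0 s2 s1 f1 w s2c s1c fs1 w0 wf.
have w_sum : 0 <= \sum_i w i * excess x s2 h i by apply: sumr_ge0.
have /eqP : \sum_i v i * excess x s1 h i = 0.
  have : 0 <= \sum_i v i * excess x s1 h i by apply: sumr_ge0.
  lra.
rewrite psumr_eq0 // => /allP vex0.
have vs1 i : i \notin s1 -> v i = 0.
  move=> is1; have [fi|/vf//] := boolP (i \in f2).
  have := vex0 i (mem_index_enum _); rewrite /= mulf_eq0 => /orP[/eqP //|].
  rewrite gt_eqF // s1ex //.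
  exact/(fintype.subsetP s2A)/(fintype.subsetP fs2).
have ws1 i : i \notin s1 -> w i = 0.
  by move=> is1; apply: wf; apply: contra is1; exact: (fintype.subsetP fs1).
have vw i : v i = w i.
  have [is1|is1] := boolP (i \in s1); last by rewrite vs1 ?ws1.
  rewrite -(bary_unique x_gp (w := v) (y := y) s1d _ _ is1); last 2 first.
  - by rewrite sum_supported.
  - by rewrite vy sum_supported // => k /vs1 ->; rewrite scale0r.
  apply: bary_unique => //; first by rewrite sum_supported.
  by rewrite [RHS]wy sum_supported // => k /ws1 ->; rewrite scale0r.
apply/hull_weightsP; exists w; split=> // i.
by rewrite inE negb_and => /orP[/wf|/vf]; rewrite ?vw.
Qed.

Lemma independentS s f : f \subset s -> affinely_independent x s ->
  affinely_independent x f.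
Proof.
move=> /fintype.subsetP fs si w w0 wx i fi.
pose w' k := if k \in f then w k else 0.
have w'f (V : nmodType) (F : R -> 'I_n -> V) : (forall k, F 0 k = 0) ->
    \sum_(k in s) F (w' k) k = \sum_(k in f) F (w k) k.
  move=> F0; rewrite [LHS]big_mkcond [RHS]big_mkcond; apply: eq_bigr => k _.
  rewrite /w'; have [/fs ->//|_] := boolP (k \in f).
  by rewrite F0; case: ifP.
have := si w' _ _ i (fs _ fi); rewrite {3}/w' fi; apply.
  by rewrite (w'f _ (fun c _ => c)).
by rewrite (w'f _ (fun c k => c *: x k)) // => k; rewrite scale0r.
Qed.

Theorem lower_hull_triangulation A h : generic h -> (d < #|A|)%N ->
  triangulation x A (lower_hull A h).
Proof.
move=> hgen dA; split.
- move=> f /lower_hullP[s /lower_cellsP[sA sd _] fs].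
  split; first exact: fintype.subset_trans sA.
  exact/(independentS fs)/simplex_independent.
- move=> f f' /lower_hullP[s sc fs] f'f; apply/lower_hullP; exists s => //.
  exact: fintype.subset_trans fs.
- move=> f1 f2 /lower_hullP[s1 s1c fs1] /lower_hullP[s2 s2c fs2].
  apply/seteqP; split=> y.
    by move=> [y1 y2]; exact: (lower_hull_inter s1c s2c fs1 fs2).
  move=> yI; split; first exact: hullS (finset.subsetIl _ _) yI.
  exact: hullS (finset.subsetIr _ _) yI.
apply/seteqP; split=> y.
  move=> [f /= /lower_hullP[s /lower_cellsP[sA _ _] fs]]; apply: hullS.
  exact: fintype.subset_trans sA.
move=> /(lower_hull_cover hgen dA)[s sc ys]; exists s => //=.
by apply/lower_hullP; exists s.
Qed.

End LowerHull.

(** * Triangulations as lower hulls *)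

Section Triangulations.
Variables (R : realType) (d n : nat) (x : 'I_n -> 'rV[R]_d).
Hypothesis x_gp : forall A : {set 'I_n}, #|A| = d.+1 -> ~ on_hyperplane x A.
Implicit Types (s f A B T : {set 'I_n}) (h w : 'I_n -> R) (y p : 'rV[R]_d)
  (K : {set {set 'I_n}}).

(** The intersection of the two simplices is a face of [f] which contains a
    point of the relative interior of [f]. *)
Lemma interior_face K A f s w : triangulation x A K -> f \in K -> s \in K ->
  (forall i, i \in f -> 0 < w i) -> \sum_(i in f) w i = 1 ->
  hull x s (\sum_(i in f) w i *: x i) -> f \subset s.
Proof.
move=> [Kind Kdown Kint _] fK sK w0 w1 ys; set y := \sum_(_ in _) _ in ys.
have yf : hull x f y by exists w; split=> // i /w0/ltW.
have : (hull x f `&` hull x s)%classic y by [].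
rewrite Kint // => -[v [v0 v1 vy]].
apply/fintype.subsetP => i fi; apply: contraLR (w0 i fi) => si.
pose v' k := if k \in s then v k else 0.
have v'E (V : nmodType) (F : R -> 'I_n -> V) : (forall k, F 0 k = 0) ->
    \sum_(k in f) F (v' k) k = \sum_(k in (f :&: s)%SET) F (v k) k.
  move=> F0; rewrite [LHS]big_mkcond [RHS]big_mkcond; apply: eq_bigr => k _.
  rewrite inE /v'; case: (k \in f) => //=; case: ifP => //.
have [_ find] := Kind f fK.
have := find (fun k => w k - v' k) _ _ i fi.
rewrite /v' (negbTE si) subr0 => -> //; first by rewrite ltxx.
  by rewrite sumrB w1 (v'E _ (fun c _ => c)) // v1 subrr.
under eq_bigr do rewrite scalerBl.
rewrite sumrB (v'E _ (fun c k => c *: x k)) -?vy ?subrr // => k.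
by rewrite scale0r.
Qed.

Lemma interior_simplex K A f s y : triangulation x A K -> f \in K -> s \in K ->
  #|f| = d.+1 -> (forall i, i \in f -> 0 < bary x f i y) -> hull x s y ->
  f \subset s.
Proof.
move=> tri fK sK fd y0 ys; apply: (interior_face tri fK sK y0).
  exact: sum_bary.
by rewrite sum_bary_x.
Qed.

Lemma leq_card_independent f : affinely_independent x f -> (#|f| <= d.+1)%N.
Proof.
move=> fi; rewrite leqNgt; apply/negP => df.
have [s sf sd] := exists_subset (ltnW df).
have [j jf js] : exists2 j, j \in f & j \notin s.
  apply/fintype.subsetPn; apply/negP => /subset_leq_card.
  by rewrite sd leqNgt df.
have cf k : k \notin f -> circuit x s j k = 0.
  move=> kf; apply: circuit_notin; apply: contra kf.
  by case/finset.setU1P => [->//|]; exact: (fintype.subsetP sf).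
have := fi (circuit x s j) _ _ j jf; rewrite circuit_apex //.
move=> H; have := oner_neq0 R; rewrite H ?eqxx // sum_supported ?sum_circuit ?sum_circuit_x //.
by move=> k /cf ->; rewrite scale0r.
Qed.

Lemma exists_superset f k : (#|f| <= k <= n)%N ->
  exists2 s : {set 'I_n}, f \subset s & #|s| = k.
Proof.
move=> /andP[fk kn].
have [|s sf sk] := @exists_subset n (~: f)%SET (k - #|f|).
  by rewrite (cardsCs (~: f)%SET) finset.setCK card_ord leq_sub2r.
exists (f :|: s); first exact: finset.subsetUl.
rewrite cardsU [X in (_ + _ - X)%N](_ : _ = 0%N) ?subn0 ?sk ?subnKC //.
apply/eqP; rewrite cards_eq0 -finset.subset0; apply/fintype.subsetP => i.
by rewrite !inE => /andP[fi /(fintype.subsetP sf)]; rewrite inE fi.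
Qed.

(** A cell of lower dimension lies in a facet of a full simplex, where some
    barycentric coordinate vanishes. *)
Lemma generic_maximal_cell K A y : triangulation x A K -> (d < #|A|)%N ->
  hull x A y ->
  (forall s i, #|s| = d.+1 -> i \in s -> bary x s i y != 0) ->
  exists s, [/\ s \in maximal_cells d K, hull x s y &
     forall i, i \in s -> 0 < bary x s i y].
Proof.
move=> [Kind _ _ Kcov] dA yA gen.
have [f /= fK yf] : (\bigcup_(f in [set` K]) hull x f)%classic y by rewrite Kcov.
have [_ fi] := Kind f fK.
have [s fs sd] : exists2 s : {set 'I_n}, f \subset s & #|s| = d.+1.
  apply: exists_superset; rewrite leq_card_independent //=.
  by rewrite (leq_trans dA) // -[leqRHS]card_ord max_card.
have ys := hullS fs yf.
have fE : f = s.
  apply/eqP; rewrite finset.eqEsubset fs /=; apply/fintype.subsetP => i si.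
  apply: contraLR (gen s i sd si) => fi0; rewrite negbK.
  have /hull_weightsP[w [w0 wf w1 wy]] := yf.
  rewrite (bary_unique x_gp (w := w) sd _ _ si) ?wf //.
    by rewrite sum_supported // => k ks; apply: wf; apply: contra ks; exact: (fintype.subsetP fs).
  rewrite sum_supported // => k ks; rewrite wf ?scale0r //.
  by apply: contra ks; exact: (fintype.subsetP fs).
exists s; split=> // [|i si]; first by rewrite inE -fE fK fE sd eqxx.
by rewrite lt0r gen //=; exact: ((hullP x_gp y sd).1 ys).
Qed.

Lemma approach_maximal_cell K A s0 y : triangulation x A K ->
  s0 \subset A -> #|s0| = d.+1 -> hull x A y ->
  exists s (p : 'rV[R]_d) (e : R), [/\ s \in maximal_cells d K, hull x s y,
    hull x s0 p, 0 < e < 1 & forall i, i \in s -> 0 < bary x s i (y + e *: (p - y))].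
Proof.
move=> tri s0A s0d yA.
have [p [e [ps0 /andP[e0 e1] gen]]] := generic_approach x_gp y s0d.
have dA : (d < #|A|)%N by rewrite -s0d subset_leq_card.
have [||s [sK ys y0]] := generic_maximal_cell (y := y + e *: (p - y)) tri dA.
- by apply: hull_conv => //; [rewrite !ltW|exact: hullS ps0].
- by move=> s i sd si; case: (gen s i sd si).
have sd : #|s| = d.+1 by move: sK; rewrite inE => /andP[_ /eqP].
exists s, p, e; split=> //; last by rewrite e0.
by apply/(hullP x_gp) => // i si; case: (gen s i sd si) => _ _; apply; exact: y0.
Qed.

(** The barycentre of [f] lies in some [s], which then contains [f]. *)
Lemma sub_covering_face K A f (P : {set 'I_n} -> Prop) :
  triangulation x A K -> f \in K -> (exists s, P s) ->
  (forall y, hull x f y -> exists s, [/\ P s, s \in K & hull x s y]) ->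
  exists2 s, P s & f \subset s.
Proof.
move=> tri fK [s0 Ps0] cov; have [f0|f0] := eqVneq f finset.set0.
  by exists s0 => //; rewrite f0 finset.sub0set.
pose w (i : 'I_n) : R := #|f|%:R^-1.
have cf : (0 < #|f|%:R :> R) by rewrite ltr0n card_gt0.
have w1 : \sum_(i in f) w i = 1.
  by rewrite /w sumr_const -[LHS]mulr_natr mulVf // gt_eqF.
have w0 i : i \in f -> 0 < w i by rewrite invr_gt0.
have [|s [Ps sK ys]] := cov (\sum_(i in f) w i *: x i).
  by exists w; split=> // i /w0/ltW.
by exists s => //; exact: (interior_face tri fK sK w0 w1 ys).
Qed.

Lemma sub_maximal_cell K A f : triangulation x A K -> (d < #|A|)%N -> f \in K ->
  exists2 s, s \in maximal_cells d K & f \subset s.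
Proof.
move=> tri dA fK; have [s0 s0A s0d] := exists_subset dA.
have cov y : hull x A y -> exists s, [/\ s \in maximal_cells d K, s \in K & hull x s y].
  move=> yA.
  have [s [_ [_ [sK ys _ _ _]]]] := approach_maximal_cell tri s0A s0d yA.
  by exists s; split=> //; move: sK; rewrite inE => /andP[].
apply: (sub_covering_face tri fK).
  have [p [p0 _]] := generic_point x_gp s0d.
  have [s [sm _ _]] := cov p (hullS s0A (bary_interior_hull x_gp s0d p0)).
  by exists s.
have [Kind _ _ _] := tri; have [fA _] := Kind f fK.
by move=> y /(hullS fA)/cov.
Qed.

(** A generic point of a lower cell lies in a maximal cell of [K], which is also
    a lower cell, so the two coincide; and maximal cells determine a
    triangulation. *)
Lemma triangulation_lower_hull K A h : triangulation x A K -> (d < #|A|)%N ->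
  generic x h -> maximal_cells d K \subset lower_cells x A h ->
  K = lower_hull x A h.
Proof.
move=> tri dA hgen /fintype.subsetP sub.
have tri' := lower_hull_triangulation x_gp hgen dA.
have eq_max s : s \in maximal_cells d K <-> s \in lower_cells x A h.
  split=> [/sub//|sc].
  have /lower_cellsP[sA sd _] := sc.
  have [p [p0 pgen]] := generic_point x_gp sd.
  have pA := hullS sA (bary_interior_hull x_gp sd p0).
  have [s' [s'K ps' _]] := generic_maximal_cell tri dA pA pgen.
  suff -> : s = s' by [].
  have /lower_cellsP[_ s'd _] := sub _ s'K.
  apply/eqP; rewrite eqEcard sd s'd leqnn andbT.
  apply: (interior_simplex tri' _ _ sd p0 ps'); apply/lower_hullP.
    by exists s.
  by exists s' => //; exact: sub.
apply/finset.setP => f; apply/idP/lower_hullP.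
  move=> /(sub_maximal_cell tri dA)[s sK fs]; exists s => //; exact/eq_max.
move=> [s /eq_max sK fs]; have [_ Kdown _ _] := tri; apply: (Kdown s) => //.
by move: sK; rewrite inE => /andP[].
Qed.

Lemma convex_functionP (D : set 'rV[R]_d) (f : 'rV[R]_d -> R) (e : R) y z :
  convex_function D f -> D y -> D z -> 0 <= e -> e <= 1 ->
  f (y + e *: (z - y)) <= f y + e * (f z - f y).
Proof.
move=> cvx Dy Dz e0 e1.
have H : f (e *: z + (1 - e) *: y) <= e * f z + (1 - e) * f y.
  exact: (cvx (Itv01 e0 e1) z y (mem_set Dz) (mem_set Dy)).
have -> : y + e *: (z - y) = e *: z + (1 - e) *: y.
  by rewrite scalerBl scale1r scalerBr addrCA.
by apply: le_trans H _; lra.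
Qed.

Section Regular.
Variables (t : {set {set 'I_n}}) (f : 'rV[R]_d -> R)
  (g : {set 'I_n} -> 'rV[R]_d -> R).
Hypotheses (t_tri : triangulation x [set: 'I_n]%SET t)
  (f_cvx : convex_function (hull x [set: 'I_n]%SET) f)
  (g_aff : forall s, s \in t -> affine (g s) /\ forall y, hull x s y -> f y = g s y)
  (g_inj : {in maximal_cells d t &, injective g}).

(** A convex function lies above its tangent: compare [y] with a nearby point of
    [s] on the segment from an interior point of [s] to [y]. *)
Lemma supporting_affine s y : s \in maximal_cells d t ->
  hull x [set: 'I_n]%SET y -> g s y <= f y.
Proof.
rewrite inE => /andP[st /eqP sd] yI; have [ga gf] := g_aff st.
have [p [p0 _]] := generic_point x_gp sd.
have [e [e0 e1 eS]] := small_step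
  (fun i => if i \in s then bary x s i p else 1) (fun i => bary x s i y - bary x s i p).
have p's : hull x s (p + e *: (y - p)).
  apply/(hullP x_gp) => // i si; rewrite affine_conv; last exact: affine_bary.
  by have [+ _ _] := eS i; rewrite si => /(_ (p0 _ si))/ltW.
have ps := bary_interior_hull x_gp sd p0.
have := convex_functionP f_cvx (hullS (finset.subsetT _) ps) yI (ltW e0) (ltW e1).
rewrite (gf _ p's) (gf _ ps) affine_conv //; nra.
Qed.

(** Points that are not vertices are lifted above the convex function, so that
    they do not appear in the lower hull. *)
Definition regular_heights i : R :=
  if [set i]%SET \in t then f (x i) else f (x i) + 1.

(** If [f] agreed with [g s] at a vertex [x j] outside [s], it would agree with
    it on the whole segment from [x j] to any point of [s], hence at an interior
    point of some other maximal cell [s'] at [x j].  As [f >= g s] everywhere,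
    this forces [g s' = g s], against the injectivity of [g]. *)
Lemma regular_excess s j : s \in maximal_cells d t -> j \notin s ->
  0 < excess x s regular_heights j.
Proof.
move=> sm js; move: (sm); rewrite inE => /andP[st /eqP sd].
have [ga gf] := g_aff st; have [_ tdown tint _] := t_tri.
have hI A : A \subset [set: 'I_n]%SET by exact: finset.subsetT.
have xI i : hull x [set: 'I_n]%SET (x i) by apply: hullS (hull1 x i).
have gE y : interp x s regular_heights y = g s y.
  apply/esym/(affine_eq_interp x_gp) => // i si.
  have it : [set i]%SET \in t by apply: (tdown s) => //; rewrite finset.sub1set.
  rewrite /regular_heights it gf //.
  by apply: hullS (hull1 x i); rewrite finset.sub1set.
rewrite /excess gE /regular_heights.
have gle := supporting_affine sm (xI j).
case: ifPn => jt; last by rewrite subr_gt0; apply: le_lt_trans gle _; rewrite ltrDl.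
rewrite subr_gt0 lt_neqAle gle andbT; apply/eqP => gj.
(* A point close to [x j] on a segment towards [s], interior to a maximal cell
   [s'] whose closure contains [x j]. *)
have [s' [p [e [s'm js' ps /andP[e0 e1] y0]]]] :=
  approach_maximal_cell t_tri (hI s) sd (xI j).
have yI : hull x [set: 'I_n]%SET (x j + e *: (p - x j)).
  by apply: hull_conv; [rewrite !ltW|exact: xI|exact: hullS ps].
have fy : f (x j + e *: (p - x j)) = g s (x j + e *: (p - x j)).
  apply/le_anti/andP; split; last exact: supporting_affine.
  apply: le_trans (convex_functionP f_cvx (xI j) (hullS (hI s) ps) (ltW e0) (ltW e1)) _.
  by rewrite affine_conv // gj (gf _ ps).
move: (s'm); rewrite inE => /andP[s't /eqP s'd].
have [g'a g'f] := g_aff s't.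
have js'_in : j \in s'.
  apply: contrapT => /negP js'_out.
  have : (hull x [set j]%SET `&` hull x s')%classic (x j) by split => //; exact: hull1.
  rewrite tint // [X in hull x X](_ : _ = finset.set0); first exact: hull0.
  apply/finset.setP => k; rewrite !inE; apply/andP => -[/eqP->] ks'.
  by rewrite ks' in js'_out.
suff gg : g s = g s' by move/negP: js; apply; rewrite (g_inj sm s'm gg).
have diff_ge i : i \in s' -> 0 <= g s' (x i) - g s (x i).
  move=> is'; rewrite subr_ge0 -(g'f (x i)); first exact: supporting_affine.
  by apply: hullS (hull1 x i); rewrite finset.sub1set.
have : \sum_(i in s') bary x s' i (x j + e *: (p - x j)) * (g s' (x i) - g s (x i)) = 0.
  set y := _ + _ in yI fy y0 *.
  have ys' : hull x s' y by apply: bary_interior_hull.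
  have E G : affine G -> \sum_(i in s') bary x s' i y * G (x i) = G y.
    move=> aG; rewrite -{2}(sum_bary_x x_gp y s'd) affine_lincomb //.
    by rewrite sum_bary // subrr mul0r addr0.
  under eq_bigr do rewrite mulrBr.
  by rewrite sumrB !E // -fy -(g'f _ ys') subrr.
move/eqP; rewrite psumr_eq0 => [/allP H|i is']; last first.
  by rewrite mulr_ge0 ?diff_ge // ltW // y0.
have eqv i : i \in s' -> g s (x i) = g s' (x i).
  move=> is'; have := H i (mem_index_enum _); rewrite is' /= mulf_eq0.
  by rewrite gt_eqF ?y0 //= subr_eq0 => /eqP.
apply/funext => y.
rewrite (affine_eq_interp x_gp (h := fun i => g s (x i)) y s'd ga) //.
by rewrite [RHS](affine_eq_interp x_gp (h := fun i => g s (x i)) y s'd g'a) // => i /eqv.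
Qed.

End Regular.
End Triangulations.

(** * Crossing one circuit is a flip *)

Section Flips.
Variables (R : realType) (d n : nat) (x : 'I_n -> 'rV[R]_d).
Hypothesis x_gp : forall A : {set 'I_n}, #|A| = d.+1 -> ~ on_hyperplane x A.
Implicit Types (s f A B T : {set 'I_n}) (h w q : 'I_n -> R) (y p : 'rV[R]_d)
  (K : {set {set 'I_n}}).

(** On the segment from [h] to [q], the excess over a simplex vanishes at the
    time [a / (a - b)], where [a] and [b] are its values at the two ends.  The
    condition, free of division, says that distinct circuits vanish at distinct
    times. *)
Definition distinct_crossings h q := forall s j s' j',
  #|s| = d.+1 -> j \notin s -> #|s'| = d.+1 -> j' \notin s' -> j |: s != j' |: s' ->
  excess x s h j * excess x s' q j' != excess x s' h j' * excess x s q j.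

Lemma setU1_exchange s s' j j' : #|s| = d.+1 -> j \notin s -> #|s'| = d.+1 ->
  j' \notin s' -> j |: s != j' |: s' -> exists2 i, i \in j |: s & i \notin j' |: s'.
Proof.
move=> sd js s'd js' ne; apply/fintype.subsetPn; apply: contra ne => sub.
by rewrite eqEcard sub !cardsU1 js js' sd s'd leqnn.
Qed.

(** The excluded equations are linear in the heights and none is trivial.
    For two distinct circuits, a point of the first that is not in the second
    has a nonzero coefficient. *)
Lemma perturb_heights h q : generic x q -> exists h',
  [/\ generic x h', distinct_crossings h' q &
    forall s j, 0 < excess x s h j -> 0 < excess x s h' j].
Proof.
move=> qgen.
pose V (sj : {set 'I_n} * 'I_n) := (#|sj.1| == d.+1) && (sj.2 \notin sj.1).
pose T (sj : {set 'I_n} * 'I_n) := sj.2 |: sj.1.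
(* The left summand indexes genericity, the right one the distinctness of
   crossing times; for irrelevant indices the coefficients are set to 1. *)
pose c (k : {set 'I_n} * 'I_n + ({set 'I_n} * 'I_n) * ({set 'I_n} * 'I_n)) i : R :=
  match k with
  | inl sj => if V sj then circuit x sj.1 sj.2 i else 1
  | inr (sj, sj') => if [&& V sj, V sj' & T sj != T sj'] then
      circuit x sj.1 sj.2 i * excess x sj'.1 q sj'.2 -
      circuit x sj'.1 sj'.2 i * excess x sj.1 q sj.2 else 1
  end.
case: (posnP n) => [n0|n0].
  have no_index (j : 'I_n) : False by case: j => j; rewrite n0.
  by exists h; split=> // [s j|s j]; case: (no_index j).
pose i0 := Ordinal n0.
have c0 k : exists i, c k i != 0.
  case: k => [[s j]|[[s j] [s' j']]] /=.
    case: (boolP (V (s, j))) => [/andP[_ js]|_].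
      by exists j; rewrite circuit_apex // oner_neq0.
    by exists i0; rewrite oner_neq0.
  case: (boolP [&& _, _ & _]) => [|_].
    rewrite /V /T /= => /and3P[/andP[/eqP sd js] /andP[/eqP s'd js'] ne].
    have [i iT iT'] := setU1_exchange sd js s'd js' ne; exists i.
    rewrite (circuit_notin _ iT') mul0r subr0 mulf_neq0 ?qgen //.
    exact: circuit_neq0.
  by exists i0; rewrite oner_neq0.
have [w [_ wc]] := avoid_hyperplanes c0.
have [e [e0 e1 eS]] := small_step
  (fun k : _ + {set 'I_n} * 'I_n => match k with
     | inl k => \sum_i c k i * h i | inr sj => excess x sj.1 h sj.2 end)
  (fun k => match k with
     | inl k => \sum_i c k i * w i | inr sj => excess x sj.1 w sj.2 end).
pose h' i := h i + e * w i.
have cE k : \sum_i c k i * h' i != 0.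
  have /= [_ _ /(_ (wc k))] := eS (inl k).
  congr (_ != 0); rewrite mulr_sumr -big_split; apply: eq_bigr => i _ /=.
  by rewrite /h'; ring.
exists h'; split.
- move=> s j sd js; have := cE (inl (s, j)).
  by rewrite /c /V /= sd eqxx js /= -excessE.
- move=> s j s' j' sd js s'd js' ne; have := cE (inr ((s, j), (s', j'))).
  rewrite /c /V /T /= sd s'd !eqxx js js' ne /= => H.
  rewrite -subr_eq0; move: H; congr (_ != 0).
  rewrite (excessE x s h') (excessE x s' h') !mulr_suml -sumrB.
  by apply: eq_bigr => i _; ring.
- by move=> s j; have /= [+ _ _] := eS (inr (s, j)); rewrite excess_lin.
Qed.

(** The circuit [T] is the only one that has different signs for [h] and [h'].
    The heights [h0] between them are flat over [T], and have the common sign of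
    [h] and [h'] over all the other circuits. *)
Section Crossing.
Variables (s0 : {set 'I_n}) (j0 : 'I_n) (h h0 h' : 'I_n -> R).
Let T := j0 |: s0.
Hypotheses (s0d : #|s0| = d.+1) (js0 : j0 \notin s0)
  (h_gen : generic x h) (h'_gen : generic x h')
  (flat : excess x s0 h0 j0 = 0)
  (off : forall s j, #|s| = d.+1 -> j \notin s -> j |: s != T ->
     0 < excess x s h j * excess x s h0 j)
  (off' : forall s j, #|s| = d.+1 -> j \notin s -> j |: s != T ->
     0 < excess x s h' j * excess x s h0 j)
  (on : excess x s0 h j0 * excess x s0 h' j0 < 0).

Let T_size : #|T| = d.+2.
Proof. by rewrite cardsU1 js0 s0d. Qed.

Let dT : (d < #|T|)%N.
Proof. by rewrite T_size. Qed.

Lemma same_sign_gt0 (a b c : R) : 0 < a * c -> 0 < b * c -> 0 < a -> 0 < b.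
Proof. by move=> ac bc a0; move: ac; rewrite pmulr_rgt0 // => c0; rewrite -(pmulr_lgt0 _ c0). Qed.

(** At the time of the crossing the lifted circuit lies on one hyperplane. *)
Lemma flat_interp s y : s \subset T -> #|s| = d.+1 -> interp x s h0 y = interp x s0 h0 y.
Proof.
move=> sT sd; apply/esym/(affine_eq_interp x_gp) => //; first exact: affine_interp.
move=> i /(fintype.subsetP sT)/finset.setU1P[->|i0]; last exact: interp_vertex.
by apply/esym/eqP; rewrite -subr_eq0; apply/eqP.
Qed.

Lemma setU1_neqT s j : ~~ (j |: s \subset T) -> j |: s != T.
Proof. by apply: contra => /eqP ->. Qed.

Let upper := [forall k in ~: T, 0 < excess x s0 h0 k].

(** Inside [T] the conditions at the points outside [T] are the same for
    all the simplices, so they hold for all of them or for none. *)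
Lemma cells_in_T h1 s :
  (forall s j, #|s| = d.+1 -> j \notin s -> j |: s != T ->
     0 < excess x s h1 j * excess x s h0 j) ->
  s \subset T ->
  (s \in lower_cells x [set: 'I_n]%SET h1) = upper && (s \in lower_cells x T h1).
Proof.
move=> o sT.
have offT k : #|s| = d.+1 -> k \notin T ->
    [/\ k \notin s, excess x s h0 k = excess x s0 h0 k &
        0 < excess x s h1 k * excess x s0 h0 k].
  move=> sd kT; have ks : k \notin s by apply: contra kT; exact: (fintype.subsetP sT).
  have E : excess x s h0 k = excess x s0 h0 k by rewrite /excess flat_interp.
  split=> //; rewrite -E; apply: o => //; apply: setU1_neqT.
  by apply: contra kT => /fintype.subsetP; apply; exact: setU11.
apply/lower_cellsP/andP.
  move=> [_ sd H]; split; last by apply/lower_cellsP; split=> // j _; exact: H.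
  apply/forall_inP => k; rewrite inE => kT; have [ks _ E] := offT k sd kT.
  by rewrite -(pmulr_rgt0 _ (H k (finset.in_setT _) ks)).
move=> [/forall_inP up /lower_cellsP[_ sd H]]; split=> // j _ js.
have [jT|jT] := boolP (j \in T); first exact: H.
have [ks _ E] := offT j sd jT.
by rewrite -(pmulr_lgt0 _ (up j _)) // inE.
Qed.

(** Only excesses over circuits different from [T] are involved. *)
Lemma cells_off_T h1 h2 s :
  (forall s j, #|s| = d.+1 -> j \notin s -> j |: s != T ->
     0 < excess x s h1 j * excess x s h0 j) ->
  (forall s j, #|s| = d.+1 -> j \notin s -> j |: s != T ->
     0 < excess x s h2 j * excess x s h0 j) ->
  ~~ (s \subset T) -> s \in lower_cells x [set: 'I_n]%SET h1 ->
  s \in lower_cells x [set: 'I_n]%SET h2.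
Proof.
move=> o1 o2 sT /lower_cellsP[sI sd H]; apply/lower_cellsP; split=> // j jI js.
have ne : j |: s != T.
  apply: setU1_neqT; apply: contra sT; apply: fintype.subset_trans.
  exact: finset.subsetUr.
exact: same_sign_gt0 (o1 _ _ sd js ne) (o2 _ _ sd js ne) (H j jI js).
Qed.

Let I := [set: 'I_n]%SET.

Lemma cells_crossing_upper : ~~ upper ->
  lower_cells x I h = lower_cells x I h'.
Proof.
move=> /negbTE up; apply/finset.setP => s.
have [sT|sT] := boolP (s \subset T); first by rewrite !cells_in_T // up.
by apply/idP/idP; exact: cells_off_T.
Qed.

Lemma excess_on i : i \in T -> excess x (T :\ i) h i * excess x (T :\ i) h' i < 0.
Proof.
move=> iT; have := on; rewrite !(excess_exchange x_gp _ s0d js0 iT) -/T.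
set l := circuit _ _ _ _; rewrite mulrACA => H.
have l0 : 0 < l * l by rewrite -expr2 exprn_even_gt0 //= circuit_neq0.
by rewrite pmulr_rlt0 in H.
Qed.

Lemma cells_of_T h1 s : generic x h1 -> (s \in lower_cells x T h1) =
  [exists i in T, (s == T :\ i) && (0 < excess x (T :\ i) h1 i)].
Proof.
move=> h1gen; apply/lower_cellsP/exists_inP.
  move=> [sT sd H].
  have [i iT is_] : exists2 i, i \in T & i \notin s.
    apply/fintype.subsetPn; apply/negP => /subset_leq_card.
    by rewrite sd T_size ltnn.
  have sE : s = T :\ i.
    apply/eqP; rewrite eqEcard; apply/andP; split.
      by rewrite finset.subsetD1 sT.
    by rewrite sd; have := cardsD1 i T; rewrite iT T_size add1n => -[<-].
  by exists i => //; rewrite {1}sE eqxx -sE H.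
move=> [i iT /andP[/eqP -> ex]]; split.
- exact: finset.subsetDl.
- by have := cardsD1 i T; rewrite iT T_size add1n => -[<-].
move=> j jT; rewrite finset.in_setD1 jT andbT negbK => /eqP ->; exact: ex.
Qed.

Lemma cells_of_T_disjoint s : s \in lower_cells x T h -> s \notin lower_cells x T h'.
Proof.
rewrite !cells_of_T // => /exists_inP[i iT /andP[/eqP -> ex]].
apply/negP => /exists_inP[k kT /andP[/eqP E ex']].
have ik : i = k.
  apply/eqP; apply: contraT => ik; have : i \in T :\ i by rewrite E finset.in_setD1 ik.
  by rewrite finset.in_setD1 eqxx.
by have := excess_on iT; rewrite ltNge; rewrite -ik in ex'; rewrite ltW // mulr_gt0.
Qed.

(** The delicate inclusion concerns a face [f] of [T] that belongs to
    cells outside [T] after the crossing and to the old triangulation of [T].  The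
    new triangulation of [T] covers [f] by cells of the new lower hull, so [f] is a
    face of one of them. *)
Lemma crossing_flip : upper -> flip x (lower_hull x I h) (lower_hull x I h').
Proof.
move=> up; exists T, (lower_hull x T h), (lower_hull x T h').
have tri1 := lower_hull_triangulation x_gp h_gen dT.
have tri2 := lower_hull_triangulation x_gp h'_gen dT.
have dI : (d < #|I|)%N by rewrite (leq_trans dT) // subset_leq_card // finset.subsetT.
have tri' := lower_hull_triangulation x_gp h'_gen dI.
have subT h1 f : (forall s j, #|s| = d.+1 -> j \notin s -> j |: s != T ->
     0 < excess x s h1 j * excess x s h0 j) ->
    f \in lower_hull x T h1 -> f \in lower_hull x I h1.
  move=> o /lower_hullP[s sc fs]; apply/lower_hullP; exists s => //.
  have /lower_cellsP[sT _ _] := sc.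
  by rewrite cells_in_T // up.
have nonempty_cells h1 : generic x h1 -> exists s, s \in lower_cells x T h1.
  move=> h1gen; have [|s sc _] := lower_hull_cover x_gp h1gen dT (y := x j0).
    by apply: hullS (hull1 x j0); rewrite finset.sub1set setU11.
  by exists s.
split=> //; first split=> //.
- have [s sc] := nonempty_cells h h_gen; apply/eqP => E.
  have : s \in maximal_cells d (lower_hull x T h') by rewrite -E maximal_lower_hull.
  by rewrite maximal_lower_hull; apply/negP/cells_of_T_disjoint.
- by apply/fintype.subsetP => f; exact: subT _ _ off.
apply/finset.setP => f; rewrite finset.in_setU finset.in_setD.
apply/idP/orP => [fK'|[/andP[f1 fK]|f2]]; last exact: subT _ _ off' f2.
  have [f2|f2] := boolP (f \in lower_hull x T h'); first by right.
  left; have /lower_hullP[s sc fs] := fK'.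
  have sT : ~~ (s \subset T).
    apply: contra f2 => sT; apply/lower_hullP; exists s => //.
    by move: sc; rewrite cells_in_T // => /andP[].
  apply/andP; split; last first.
    by apply/lower_hullP; exists s => //; exact: cells_off_T off' off sT sc.
  apply: contra f2 => f1.
  have fT : f \subset T.
    have /lower_hullP[s1 /lower_cellsP[s1T _ _] fs1] := f1.
    exact: fintype.subset_trans fs1 s1T.
  have [||s2 s2c fs2] := sub_covering_face (P := fun s => s \in lower_cells x T h') tri' fK'.
  - by have [s2] := nonempty_cells h' h'_gen; exists s2.
  - move=> y /(hullS fT) /(lower_hull_cover x_gp h'_gen dT)[s2 s2c ys2].
    exists s2; split=> //; apply: (subT _ _ off').
    by apply/lower_hullP; exists s2.
  by apply/lower_hullP; exists s2.
have /lower_hullP[s sc fs] := fK; apply/lower_hullP; exists s => //.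
apply: (cells_off_T off off' _ sc); apply: contra f1 => sT.
by apply/lower_hullP; exists s => //; move: sc; rewrite cells_in_T // => /andP[].
Qed.

End Crossing.
End Flips.

(** * The parabolic functional decreases *)

Section CircuitVolume.
Variables (R : realType) (d n : nat) (x : 'I_n -> 'rV[R]_d).
Hypothesis x_gp : forall A : {set 'I_n}, #|A| = d.+1 -> ~ on_hyperplane x A.
Implicit Types (s f A B T : {set 'I_n}) (h w q : 'I_n -> R) (y p : 'rV[R]_d)
  (K : {set {set 'I_n}}) (e : 'I_(1 + d) -> 'I_n).

Lemma mul_vertex_mx e (w : 'rV[R]_(1 + d)) : w *m vertex_mx (x \o e) =
  row_mx (\sum_k w 0 k)%:M (\sum_k w 0 k *: x (e k)).
Proof.
rewrite mulmx_sum_row; under eq_bigr do rewrite rowK.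
elim/big_rec3: _ => [|i a v u _ ->]; first by rewrite raddf0 row_mx0.
by rewrite scale_row_mx add_row_mx scale_scalar_mx mulr1 raddfD.
Qed.

Lemma sum_enum (V : nmodType) e s (F : 'I_n -> V) : injective e -> e @: finset.setT = s ->
  \sum_(i in s) F i = \sum_k F (e k).
Proof.
move=> einj <-; rewrite big_imset => [|? ? _ _ /einj //].
by apply: eq_bigl => k; rewrite inE.
Qed.

Lemma inj_extend e (w : 'I_(1 + d) -> R) : injective e -> exists W : 'I_n -> R,
  (forall k, W (e k) = w k) /\ ((forall k, 0 <= w k) -> forall i, 0 <= W i).
Proof.
move=> einj; exists (fun i => \sum_k (e k == i)%:R * w k); split=> [k|w0 i].
  rewrite (bigD1 k) //= eqxx mul1r big1 ?addr0 // => l lk.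
  by rewrite (inj_eq einj) (negbTE lk) mul0r.
by apply: sumr_ge0 => k _; rewrite mulr_ge0.
Qed.

Lemma vertex_mx_unit e s : injective e -> e @: finset.setT = s -> #|s| = d.+1 ->
  vertex_mx (x \o e) \in unitmx.
Proof.
move=> einj es sd; rewrite -row_free_unit -kermx_eq0; apply/eqP/row_matrixP => k.
rewrite row0; set w := row k _.
have : w *m vertex_mx (x \o e) = row_mx 0 0.
  by rewrite row_mx0 -row_mul mulmx_ker row0.
rewrite mul_vertex_mx => /eq_row_mx[/matrixP/(_ 0 0) w0 wx].
rewrite !mxE mulr1n in w0.
have [W [WE W0]] := inj_extend (w 0) einj.
apply/rowP => k'; rewrite [RHS]mxE -WE.
apply: (simplex_independent x_gp sd (w := W)).
- by rewrite (sum_enum _ einj es); under eq_bigr do rewrite WE.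
- by rewrite (sum_enum _ einj es); under eq_bigr do rewrite WE.
- by rewrite -es imset_f ?inE.
Qed.

Lemma volume_hull e s : injective e -> e @: finset.setT = s -> #|s| = d.+1 ->
  volume (hull x s) = (`|\det (vertex_mx (x \o e))|%:E * volume (@corner_simplex R d))%E.
Proof.
move=> einj es sd; rewrite -volume_simplex; last exact: vertex_mx_unit es sd.
congr volume; apply/seteqP; split=> y.
  move=> [w [w0 w1 ->]]; exists (\row_k w (e k)); split=> [k|].
    by rewrite mxE w0 // -es imset_f ?inE.
  rewrite mul_vertex_mx -w1 !(sum_enum _ einj es).
  by congr (row_mx _%:M _); apply: eq_bigr => k _; rewrite mxE.
move=> [w [w0]]; rewrite mul_vertex_mx => /eq_row_mx[/matrixP/(_ 0 0) w1 ->].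
rewrite !mxE !mulr1n in w1.
have [W [WE W0]] := inj_extend (w 0) einj.
exists W; split=> [i _||].
- exact: W0.
- by rewrite (sum_enum _ einj es); under eq_bigr do rewrite WE.
- by rewrite (sum_enum _ einj es); apply: eq_bigr => k _; rewrite WE.
Qed.

Lemma enum_simplex s i : #|s| = d.+1 -> i \in s ->
  exists e, [/\ injective e, e (lshift d 0) = i & e @: finset.setT = s].
Proof.
move=> sd si; pose l := enum (s :\ i).
have ls : size l = d.
  by rewrite -cardE; have := cardsD1 i s; rewrite si sd add1n => -[].
have lu : uniq l by rewrite enum_uniq.
have il : i \notin l by rewrite mem_enum !inE eqxx.
pose e (k : 'I_(1 + d)) := if fintype.split k is inr m then nth i l (m : 'I_d) else i.
have e0 k : e (lshift d k) = i by rewrite /e (unsplitK (inl _ k)).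
have e1 k : e (rshift 1 k) = nth i l k by rewrite /e (unsplitK (inr _ k)).
have lk (k : 'I_d) : nth i l k \in l by rewrite mem_nth // ls.
have einj : injective e.
  move=> k k'; case: (split_ordP k) => m ->; case: (split_ordP k') => m' ->;
    rewrite ?e0 ?e1.
  - by rewrite !ord1.
  - by move=> E; rewrite {1}E lk in il.
  - by move=> E; rewrite -{1}E lk in il.
  - by move/eqP; rewrite nth_uniq ?ls // => /eqP/val_inj ->.
exists e; split=> //; apply/eqP; rewrite eqEcard; apply/andP; split; last first.
  by rewrite card_imset // cardsT card_ord sd.
apply/fintype.subsetP => _ /imsetP[k _ ->].
case: (split_ordP k) => m ->; rewrite ?e0 ?e1 //.
by have := lk m; rewrite mem_enum !inE => /andP[].
Qed.

(** The cell opposite to [i] arises from [s] by replacing the vertex [i] by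
    [j].  In homogeneous coordinates this replaces a row by a combination of
    rows in which the old row has coefficient [bary s i (x j)]. *)
Lemma circuit_volume s j : #|s| = d.+1 -> j \notin s ->
  exists2 v : R, 0 < v & forall i, i \in j |: s ->
    fine (volume (hull x ((j |: s) :\ i))) = v * `|circuit x s j i|.
Proof.
move=> sd js; have [c0 cy] := volume_corner_simplex R d.
set c := volume _ in c0 cy.
have cE : c = (fine c)%:E by rewrite fineK // ge0_fin_numE // ltW.
have fc0 : 0 < fine c by rewrite fine_gt0 // c0 cy.
have volE e s' : injective e -> e @: finset.setT = s' -> #|s'| = d.+1 ->
    fine (volume (hull x s')) = `|\det (vertex_mx (x \o e))| * fine c.
  by move=> einj es s'd; rewrite (volume_hull einj es s'd) -/c cE -EFinM.
have [i1 i1s] : exists i, i \in s by apply/card_gt0P; rewrite sd.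
exists (fine (volume (hull x s))).
  have [e [einj _ es]] := enum_simplex sd i1s.
  rewrite (volE e) // mulr_gt0 // normr_gt0 -unitfE -unitmxE.
  exact: vertex_mx_unit es sd.
move=> i /finset.setU1P[->|si].
  by rewrite circuit_apex // normr1 mulr1 setU1K.
have [e [einj ei es]] := enum_simplex sd si.
have ij : i != j by apply: contraNneq js => <-.
(* The enumeration [e] of [s] starts with [i], which [e'] replaces by [j]. *)
pose e' k := if k == lshift d 0 then j else e k.
have e'inj : injective e'.
  have ej k : e k != j.
    by apply: contraNneq js => <-; rewrite -es imset_f ?inE.
  move=> k k'; rewrite /e'; do 2 case: eqP => [->|?] //.
  - by move/esym/eqP; rewrite (negbTE (ej _)).
  - by move/eqP; rewrite (negbTE (ej _)).
  - exact: einj.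
have iT : i \in j |: s by rewrite !inE si orbT.
have T'd := card_exchange sd js iT.
have e's : e' @: finset.setT = (j |: s) :\ i.
  apply/eqP; rewrite eqEcard card_imset // cardsT card_ord T'd leqnn andbT.
  apply/fintype.subsetP => _ /imsetP[k _ ->]; rewrite /e' !inE.
  case: (k =P lshift d 0) => [_|/eqP k0]; first by rewrite eqxx andbT eq_sym ij.
  have ks : e k \in s by rewrite -es imset_f ?inE.
  rewrite ks orbT andbT; apply: contra k0 => /eqP ki.
  by apply/eqP/einj; rewrite ki ei.
rewrite (volE e' _ e'inj e's T'd) (volE e _ einj es sd) mulrAC; congr (_ * _).
pose b := \row_k bary x s (e k) (x j).
have -> : vertex_mx (x \o e') =
    block_mx (lsubmx b) (rsubmx b) 0 1%:M *m vertex_mx (x \o e).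
  apply/row_matrixP => k; rewrite row_mul rowK /=.
  case: (split_ordP k) => m ->; rewrite /e'.
    have -> : row (lshift d m) (block_mx (lsubmx b) (rsubmx b) 0 1%:M) = b.
      by rewrite rowKu hsubmxK row_id.
    rewrite (ord1 m) eqxx mul_vertex_mx.
    rewrite -[in LHS](sum_bary_x x_gp (x j) sd) -[in LHS](sum_bary x_gp (x j) sd).
    rewrite !(sum_enum _ einj es).
    by congr (row_mx _%:M _); apply: eq_bigr => k' _; rewrite mxE.
  rewrite rowKd row_row_mx row0 row1.
  rewrite (_ : row_mx 0 (delta_mx 0 m) = delta_mx 0 (rshift 1 m)); last first.
    apply/rowP => l; case: (split_ordP l) => l' ->.
      by rewrite row_mxEl !mxE eq_lrshift.
    by rewrite row_mxEr !mxE (inj_eq (@rshift_inj _ _)).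
  by rewrite -rowE rowK.
rewrite det_mulmx det_ublock det1 mulr1 normrM mulrC; congr (_ * _).
rewrite /circuit (negbTE ij) sub0r normrN; congr `|_|.
by rewrite det_mx11 !mxE ei.
Qed.

End CircuitVolume.

Section CrossingVr.
Variables (R : realType) (d n : nat) (x : 'I_n -> 'rV[R]_d).
Hypothesis x_gp : forall A : {set 'I_n}, #|A| = d.+1 -> ~ on_hyperplane x A.
Variables (s0 : {set 'I_n}) (j0 : 'I_n) (h h0 h' : 'I_n -> R).
Let T := j0 |: s0.
Let I := [set: 'I_n]%SET.
Hypotheses (s0d : #|s0| = d.+1) (js0 : j0 \notin s0)
  (h_gen : generic x h) (h'_gen : generic x h')
  (flat : excess x s0 h0 j0 = 0)
  (off : forall (s : {set 'I_n}) j, #|s| = d.+1 -> j \notin s -> j |: s != T ->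
     0 < excess x s h j * excess x s h0 j)
  (off' : forall (s : {set 'I_n}) j, #|s| = d.+1 -> j \notin s -> j |: s != T ->
     0 < excess x s h' j * excess x s h0 j)
  (on : excess x s0 h j0 * excess x s0 h' j0 < 0).

Lemma sum_cells_of_T (F : {set 'I_n} -> R) h1 : generic x h1 ->
  \sum_(s in lower_cells x T h1) F s =
  \sum_(i in T) (if 0 < excess x (T :\ i) h1 i then F (T :\ i) else 0).
Proof.
move=> h1gen; rewrite -big_mkcondr /=.
pose P := finset (fun i => (i \in T) && (0 < excess x (T :\ i) h1 i)).
transitivity (\sum_(i in P) F (T :\ i)); last first.
  by apply: eq_bigl => i; rewrite inE.
rewrite -(big_imset F (h := fun i => T :\ i)) => [|i k]; last first.
  rewrite [i \in P]inE [k \in P]inE => /andP[iT _] /andP[kT _] E; apply/eqP; apply: contraT => ik.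
  have : i \in T :\ i by rewrite E finset.in_setD1 ik.
  by rewrite finset.in_setD1 eqxx.
apply: eq_bigl => s; rewrite (cells_of_T s0d js0) //.
apply/exists_inP/imsetP => [[i iT /andP[/eqP -> ex]]|[i]].
  by exists i => //; rewrite [i \in P]inE iT.
by rewrite [i \in P]inE => /andP[iT ex] ->; exists i; rewrite ?eqxx.
Qed.

(** Let [W] be the sum of the squared norms over [T].  The cell opposite to [i]
    contributes a multiple of [(W - q i) * `|l i|], with one sign if it
    disappears and the other if it appears.  Since these signs are those of
    [l i] up to a common factor, the difference of the two values of [Vr] is,
    up to a factor, the sum of [l i * (W - q i)] over [T], where [W] drops out
    because the sum of the [l i] is zero. *)
Lemma crossing_Vr : [forall k in ~: T, 0 < excess x s0 h0 k] ->
  excess x s0 h j0 * excess x s0 (fun i => enorm (x i) ^+ 2) j0 < 0 ->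
  Vr x (lower_hull x I h') < Vr x (lower_hull x I h).
Proof.
pose q i := enorm (x i) ^+ 2; rewrite -/q => up hq.
rewrite /Vr !maximal_lower_hull //.
pose F (s : {set 'I_n}) := (\sum_(i in s) q i) * fine (volume (hull x s)).
change (\sum_(s in lower_cells x I h') F s < \sum_(s in lower_cells x I h) F s).
have in_T h1 : (forall (s : {set 'I_n}) j, #|s| = d.+1 -> j \notin s -> j |: s != T ->
     0 < excess x s h1 j * excess x s h0 j) ->
    \sum_(s in lower_cells x I h1 | s \subset T) F s =
    \sum_(s in lower_cells x T h1) F s.
  move=> o; apply: eq_bigl => s; have [sT|sT] := boolP (s \subset T).
    by rewrite andbT (cells_in_T x_gp s0d flat o sT) up.
  rewrite andbF; apply/esym/negP => /lower_cellsP[sT' _ _].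
  by rewrite sT' in sT.
have split_T (C : {set {set 'I_n}}) : \sum_(s in C) F s =
    \sum_(s in C | s \subset T) F s + \sum_(s in C | ~~ (s \subset T)) F s.
  exact: bigID.
rewrite !split_T.
rewrite [X in _ + X](_ : _ = \sum_(s in lower_cells x I h | ~~ (s \subset T)) F s).
  rewrite ltrD2r !in_T // !sum_cells_of_T // -subr_lt0 -sumrB.
  have [v v0 vol] := circuit_volume x_gp s0d js0.
  pose W := \sum_(i in T) q i; pose D := excess x s0 h j0.
  pose l := circuit x s0 j0.
  rewrite (eq_bigr (fun i => v * Num.sg D * (l i * q i - l i * W))) => [|i iT].
    rewrite -mulr_sumr sumrB -mulr_suml.
    have lT i : i \notin T -> l i = 0 by exact: circuit_notin.
    rewrite !(sum_supported (A := T)) => [|i /lT->|i /lT->]; rewrite ?mul0r //.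
    rewrite sum_circuit // mul0r subr0 -excessE -mulrA pmulr_rlt0 //.
    move: hq; rewrite -/D; have [D0|D0|->] := ltrgt0P D.
    - by rewrite gtr0_sg // mul1r pmulr_rlt0.
    - by rewrite ltr0_sg // mulN1r oppr_lt0 nmulr_rlt0.
    - by rewrite mul0r ltxx.
  have Fi : F (T :\ i) = (W - q i) * (v * `|l i|).
    rewrite /F vol //; congr (_ * _); rewrite /W [in RHS](big_setD1 i) //=.
    by rewrite addrC addrK.
  (* The excess over the cell opposite to [i] has the sign of [D] times that of
     [l i], and it is negated by the crossing. *)
  have lE : D = l i * excess x (T :\ i) h i by apply: excess_exchange.
  have := excess_on x_gp s0d js0 on iT; rewrite -/T in lE *.
  have := congr1 Num.sg lE; rewrite sgrM => ->.
  rewrite Fi [`|l i|]normrEsg.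
  case: (ltrgt0P (excess x (T :\ i) h i)) => [E0|E0|->]; last by rewrite mul0r ltxx.
    by rewrite pmulr_rlt0 // => E'; rewrite ltNge ltW //= (gtr0_sg E0); ring.
  by rewrite nmulr_rlt0 // => E'; rewrite E' (ltr0_sg E0); ring.
apply: eq_bigl => s; have [sT|sT] := boolP (s \subset T); rewrite ?andbF ?andbT //.
by apply/idP/idP; [exact: cells_off_T off' off sT|exact: cells_off_T off off' sT].
Qed.

End CrossingVr.

(** * The Delaunay triangulation as a lower hull *)

Section Delaunay.
Variables (R : realType) (d n : nat) (x : 'I_n -> 'rV[R]_d).
Hypotheses (x_inj : injective x) (x_gp : general_position x).
Implicit Types (s f A B T : {set 'I_n}) (u c y : 'rV[R]_d).
Let x_gp1 := x_gp.1.

Definition paraboloid i : R := enorm (x i) ^+ 2.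

Lemma dot_ge0 u : 0 <= dot u u.
Proof. by apply: sumr_ge0 => i _; rewrite -expr2 sqr_ge0. Qed.

Lemma sqr_enorm u : enorm u ^+ 2 = dot u u.
Proof. by rewrite sqr_sqrtr // dot_ge0. Qed.

Lemma dot_eq0 u : dot u u = 0 -> u = 0.
Proof.
move=> /eqP; rewrite psumr_eq0 => [/allP u0|i _]; last by rewrite -expr2 sqr_ge0.
apply/rowP => i; have := u0 i (mem_index_enum _).
by rewrite mulf_eq0 orbb mxE => /eqP.
Qed.

Lemma sqr_dist u c : enorm (u - c) ^+ 2 = dot u u - (2 * dot c u - dot c c).
Proof.
rewrite sqr_enorm /dot mulr_sumr -!sumrB; apply: eq_bigr => i _.
rewrite !mxE; ring.
Qed.

Lemma affine_power c (k : R) : affine (fun y => 2 * dot c y - dot c c + k).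
Proof.
exists (2 *: c), (k - dot c c) => y; rewrite addrAC -addrA; congr (_ + _).
  by rewrite /dot mulr_sumr; apply: eq_bigr => i _; rewrite mxE mulrA.
Qed.

Lemma affine_powerE (g : 'rV[R]_d -> R) : affine g ->
  exists c k, forall y, g y = 2 * dot c y - dot c c + k.
Proof.
move=> [a [b gE]]; exists (2^-1 *: a), (b + dot (2^-1 *: a) (2^-1 *: a)) => y.
rewrite gE addrA [X in X + _ + _](_ : _ = dot a y - dot (2^-1 *: a) (2^-1 *: a)).
  ring.
congr (_ - _); rewrite /dot mulr_sumr; apply: eq_bigr => i _; rewrite mxE.
by rewrite !mulrA divff ?mul1r // pnatr_eq0.
Qed.

(** Over the paraboloid, the excess is the power of a point with respect to the
    circumscribed sphere of [s]. *)
Lemma excess_paraboloid s : #|s| = d.+1 -> exists c k, forall j,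
  excess x s paraboloid j = enorm (x j - c) ^+ 2 - k.
Proof.
move=> sd; have [c [k gE]] := affine_powerE (affine_interp x s paraboloid).
by exists c, k => j; rewrite /excess gE /paraboloid sqr_dist sqr_enorm; ring.
Qed.

(** A vanishing excess puts [d+2] points on one sphere.  Its radius is positive
    because the points are distinct. *)
Lemma paraboloid_generic : generic x paraboloid.
Proof.
move=> s j sd js; apply/eqP => ex0.
have [c [k exE]] := excess_paraboloid sd.
have distE i : i \in j |: s -> enorm (x i - c) ^+ 2 = k.
  move=> iT; apply/eqP; rewrite -subr_eq0 -exE; apply/eqP.
  by case/finset.setU1P: iT => [->//|si]; exact: excess_vertex.
apply: (x_gp.2 (j |: s)); first by rewrite cardsU1 js sd.
have k0 : 0 <= k by rewrite -(distE j) ?setU11 // sqr_ge0.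
exists c, (Num.sqrt k); split; last first.
  by move=> i iT; rewrite -(distE i) // sqrtr_sqr ger0_norm // sqrtr_ge0.
rewrite sqrtr_gt0 lt_neqAle k0 andbT; apply/eqP => k00.
have xc i : i \in j |: s -> x i = c.
  move=> iT; apply/eqP; rewrite -subr_eq0; apply/eqP/dot_eq0.
  by rewrite -sqr_enorm distE.
have /card_gt0P[i si] : (0 < #|s|)%N by rewrite sd.
have ij : i = j by apply: x_inj; rewrite !xc // !inE ?eqxx ?si ?orbT.
by rewrite -ij si in js.
Qed.

(** A point lies outside the circumscribed sphere exactly when its power is
    nonnegative, and the power is the excess. *)
Lemma Delaunay_cell s : #|s| = d.+1 ->
  s \in lower_cells x [set: 'I_n]%SET paraboloid <-> empty_circumsphere x s.
Proof.
move=> sd; split=> [sc|[c [r [on_s empty]]]].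
  have [c [k exE]] := excess_paraboloid sd.
  exists c, (Num.sqrt k); split=> [i si|j].
    have := excess_vertex x_gp1 paraboloid sd si; rewrite exE => /eqP.
    by rewrite subr_eq0 => /eqP <-; rewrite sqrtr_sqr ger0_norm // sqrtr_ge0.
  have := excess_ge0 x_gp1 sc (finset.in_setT j); rewrite exE subr_ge0 => kj.
  apply/negP; rewrite -leNgt -[leRHS]ger0_norm ?sqrtr_ge0 // -sqrtr_sqr.
  exact: ler_wsqrtr.
apply/lower_cellsP; split=> [|//|j _ js]; first exact: finset.subsetT.
have r0 : 0 <= r.
  have /card_gt0P[i si] : (0 < #|s|)%N by rewrite sd.
  by rewrite -(on_s i si) sqrtr_ge0.
rewrite lt0r paraboloid_generic //=.
rewrite /excess -(affine_eq_interp x_gp1 (x j) sd (affine_power c (r ^+ 2))).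
  have : r ^+ 2 <= enorm (x j - c) ^+ 2.
    rewrite ler_pXn2r // ?nnegrE ?sqrtr_ge0 //.
    by rewrite leNgt; apply/negP; exact: empty.
  rewrite sqr_dist /paraboloid sqr_enorm; lra.
move=> i si; have := congr1 (fun a => a ^+ 2) (on_s i si).
rewrite /= sqr_dist /paraboloid sqr_enorm; lra.
Qed.

End Delaunay.

(** * Deforming the heights to the paraboloid *)

Section Path.
Variables (R : realType) (d n : nat) (x : 'I_n -> 'rV[R]_d).
Hypothesis x_gp : forall A : {set 'I_n}, #|A| = d.+1 -> ~ on_hyperplane x A.
Implicit Types (s f A B T : {set 'I_n}) (h q : 'I_n -> R).
Let I := [set: 'I_n]%SET.

(** The pairs whose circuit has yet to change sign on the way from [h] to [q];
    their number measures the progress of the deformation. *)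
Definition crossings q h : {set {set 'I_n} * 'I_n} :=
  [set sj : {set 'I_n} * 'I_n | [&& #|sj.1| == d.+1, sj.2 \notin sj.1 &
    excess x sj.1 h sj.2 * excess x sj.1 q sj.2 < 0]]%SET.

Lemma crossings0 q h : generic x q -> generic x h -> crossings q h = finset.set0 ->
  lower_hull x I h = lower_hull x I q.
Proof.
move=> qg hg c0.
have pos s j : #|s| = d.+1 -> j \notin s -> 0 < excess x s h j * excess x s q j.
  move=> sd js; rewrite lt0r mulf_neq0 ?hg ?qg //= leNgt.
  apply/negP => neg; have : (s, j) \in crossings q h by rewrite inE sd js eqxx.
  by rewrite c0 inE.
have cE : lower_cells x I h = lower_cells x I q.
  apply/finset.setP => s; apply/lower_cellsP/lower_cellsP => -[sI sd H];
    split=> // j jI js; have := pos s j sd js.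
    by rewrite pmulr_rgt0 // H.
  by rewrite pmulr_lgt0 // H.
by rewrite /lower_hull cE.
Qed.

Lemma root_in_01 (A0 B0 : R) : A0 * B0 < 0 -> 0 < A0 / (A0 - B0) < 1.
Proof.
move=> AB0; have [A0p|A0n] := ltP 0 A0.
  have D : 0 < A0 - B0 by nra.
  by rewrite divr_gt0 //= ltr_pdivrMr //; nra.
have D : A0 - B0 < 0 by nra.
rewrite -mulrNN -invrN divr_gt0 ?ltr_pdivrMr ?oppr_gt0 //=; nra.
Qed.

Lemma root_flat (A0 B0 : R) : A0 * B0 < 0 -> A0 + A0 / (A0 - B0) * (B0 - A0) = 0.
Proof. by move=> AB0; field; apply/eqP => E; nra. Qed.

(** [A0] and [B0] are the end values of the excess that vanishes first, at time
    [rho]; any other excess still has its initial sign at that time. *)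
Lemma sign_before_root (A B A0 B0 : R) (rho := A0 / (A0 - B0)) :
  A0 * B0 < 0 -> A != 0 -> B != 0 -> A * B0 != A0 * B ->
  (A * B < 0 -> rho <= A / (A - B)) -> 0 < A * (A + rho * (B - A)).
Proof.
move=> AB0 An Bn ne le_rho.
have D0 : A0 - B0 != 0 by apply/eqP => E; nra.
have rho01 := root_in_01 AB0; rewrite -/rho in rho01.
case/andP: rho01 => r0 r1.
have A2 : 0 < A * A by rewrite -expr2 exprn_even_gt0.
have [AB|AB] := ltP (A * B) 0; last by nra.
have DAB : A - B != 0 by apply/eqP => E; nra.
have lt_rho : rho < A / (A - B).
  rewrite lt_neqAle le_rho // andbT; apply: contra ne => /eqP E.
  apply/eqP; have : A0 * (A - B) = A * (A0 - B0).
    by apply/eqP; rewrite -eqr_div // eq_sym; apply/eqP; rewrite -/rho E.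
  lra.
have -> : A * (A + rho * (B - A)) = A * (A - B) * (A / (A - B) - rho) by field.
by rewrite mulr_gt0 ?subr_gt0 //; nra.
Qed.

(** [h0] are the heights at the earliest zero of an excess and [h'] the heights
    shortly after it. *)
Lemma first_crossing q h : generic x q -> generic x h -> distinct_crossings x h q ->
  crossings q h != finset.set0 ->
  exists s0 j0 h0 h', let T := j0 |: s0 in
   [/\ #|s0| = d.+1, j0 \notin s0, excess x s0 h0 j0 = 0,
      excess x s0 h j0 * excess x s0 q j0 < 0 &
   [/\ generic x h', distinct_crossings x h' q, (#|crossings q h'| < #|crossings q h|)%N &
   [/\ forall s j, #|s| = d.+1 -> j \notin s -> j |: s != T ->
        0 < excess x s h j * excess x s h0 j,
      forall s j, #|s| = d.+1 -> j \notin s -> j |: s != T ->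
        0 < excess x s h' j * excess x s h0 j &
      excess x s0 h j0 * excess x s0 h' j0 < 0]]].
Proof.
move=> qg hg hs /finset.set0Pn[sj1 sj1c].
pose rho (sj : {set 'I_n} * 'I_n) : R :=
  excess x sj.1 h sj.2 / (excess x sj.1 h sj.2 - excess x sj.1 q sj.2).
case: (@Order.TotalTheory.arg_minP _ _ _ sj1 (fun sj => sj \in crossings q h) rho sj1c).
move=> [s0 j0]; rewrite inE /= => /and3P[/eqP s0d js0 neg0] rho_min.
pose r := rho (s0, j0); pose dir i := q i + (-1) * h i.
have dirE s j : excess x s dir j = excess x s q j - excess x s h j.
  by rewrite excess_lin mulN1r.
pose h0 i := h i + r * dir i.
have h0E s j : excess x s h0 j = excess x s h j + r * (excess x s q j - excess x s h j).
  by rewrite excess_lin dirE.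
have flat : excess x s0 h0 j0 = 0.
  by rewrite h0E; exact: root_flat.
have off s j : #|s| = d.+1 -> j \notin s -> j |: s != j0 |: s0 ->
    0 < excess x s h j * excess x s h0 j.
  move=> sd js ne; rewrite h0E; apply: sign_before_root => //; rewrite ?hg ?qg //.
    exact: hs.
  by move=> neg; apply: (rho_min (s, j)); rewrite inE /= sd eqxx js.
have [e [e0 e1 eS]] := small_step
  (fun sj : {set 'I_n} * 'I_n => excess x sj.1 h0 sj.2)
  (fun sj => (1 - r) * (excess x sj.1 q sj.2 - excess x sj.1 h sj.2)).
(* The same heights, seen from [h] at time [tau] and from [h0] at time [e]. *)
pose tau := r + e * (1 - r).
pose h' i := h i + tau * dir i.
have h'E s j : excess x s h' j = excess x s h j + tau * (excess x s q j - excess x s h j).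
  by rewrite excess_lin dirE.
have h'E0 s j : excess x s h' j = excess x s h0 j +
    e * ((1 - r) * (excess x s q j - excess x s h j)).
  by rewrite h'E h0E /tau; ring.
have off' s j : #|s| = d.+1 -> j \notin s -> j |: s != j0 |: s0 ->
    0 < excess x s h' j * excess x s h0 j.
  move=> sd js ne; have := off s j sd js ne; have [/= pos neg _] := eS (s, j).
  rewrite h'E0; have [a0|a0|->] := ltrgt0P (excess x s h0 j).
  - by move=> _; rewrite mulr_gt0 // pos.
  - by move=> _; rewrite nmulr_lgt0 // neg.
  - by rewrite mulr0 ltxx.
have on_T s j : #|s| = d.+1 -> j \notin s -> j |: s = j0 |: s0 ->
    excess x s h' j = e * excess x s q j.
  move=> sd js TE; suff ex0 : excess x s h0 j = 0.
    rewrite h'E0 ex0 add0r; congr (_ * _); move: ex0; rewrite h0E.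
    set a := excess x s h j; set b := excess x s q j; lra.
  have jT : j \in j0 |: s0 by rewrite -TE setU11.
  have := excess_exchange x_gp h0 s0d js0 jT; rewrite flat -TE setU1K // => /esym/eqP.
  by rewrite mulf_eq0 (negbTE (circuit_neq0 x_gp s0d js0 jT)) => /eqP.
have h'g : generic x h'.
  move=> s j sd js; have [TE|ne] := eqVneq (j |: s) (j0 |: s0).
    by rewrite on_T // mulf_neq0 ?qg // gt_eqF.
  by have := off' s j sd js ne; apply: contraTneq => ->; rewrite mul0r ltxx.
have /andP[_ r1] := root_in_01 neg0; rewrite -[_ / _]/r in r1.
exists s0, j0, h0, h'; split=> //; split=> //.
- move=> s j s' j' sd js s'd js' ne; have := hs s j s' j' sd js s'd js' ne.
  rewrite -subr_eq0 -[in X in _ -> X]subr_eq0 !h'E => H.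
  set a := excess x s h j in H *; set b := excess x s q j in H *.
  set a' := excess x s' h j' in H *; set b' := excess x s' q j' in H *.
  rewrite (_ : _ - _ = (1 - tau) * (a * b' - a' * b)); last by ring.
  rewrite mulf_neq0 // subr_eq0 eq_sym lt_eqF // /tau; nra.
- apply: proper_card; apply/properP; split; last first.
    exists (s0, j0); first by rewrite inE /= s0d eqxx js0.
    rewrite inE /= s0d eqxx js0 /= on_T // -leNgt -mulrA mulr_ge0 ?(ltW e0) //.
    by rewrite -expr2 sqr_ge0.
  apply/fintype.subsetP => -[s j]; rewrite !inE /= => /and3P[/eqP sd js neg].
  rewrite sd eqxx js /=; have [TE|ne] := eqVneq (j |: s) (j0 |: s0).
    move: neg; rewrite on_T // ltNge -mulrA mulr_ge0 ?(ltW e0) //.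
    by rewrite -expr2 sqr_ge0.
  have := off s j sd js ne; have := off' s j sd js ne; move: neg.
  set a := excess x s h j; set a' := excess x s h' j; set a0 := excess x s h0 j.
  set b := excess x s q j; nra.
- split=> //; rewrite on_T // mulrCA pmulr_rlt0 //.
Qed.

End Path.

Section FlipPath.
Variables (R : realType) (d n : nat) (x : 'I_n -> 'rV[R]_d).
Hypotheses (x_inj : injective x) (x_gp : general_position x) (dn : (d < n)%N).
Let I := [set: 'I_n]%SET.
Let q := paraboloid x.

Lemma flip_path (h : 'I_n -> R) : generic x h -> distinct_crossings x h q ->
  exists (m : nat) (u : nat -> {set {set 'I_n}}),
    [/\ u 0%N = lower_hull x I h, u m = lower_hull x I q,
        forall k : nat, (k <= m)%N -> triangulation x I (u k)
      & forall k : nat, (k < m)%N ->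
          flip x (u k) (u k.+1) /\ Vr x (u k.+1) < Vr x (u k)].
Proof.
have gp1 := x_gp.1; have qg : generic x q := paraboloid_generic x_inj x_gp.
have dI : (d < #|I|)%N by rewrite cardsT card_ord.
have [N] := ubnP #|crossings x q h|; elim: N h => // N IH h leN hg hs.
have [c0|c0] := eqVneq (crossings x q h) finset.set0.
  exists 0%N, (fun=> lower_hull x I h); split=> //.
    exact: crossings0.
  by move=> k _; exact: lower_hull_triangulation.
have [s0 [j0 [h0 [h' [s0d js0 flat neg [h'g h's lt_c [off off' on]]]]]]] :=
  first_crossing gp1 qg hg hs c0.
have [m [u [u0 um utri uflip]]] := IH h' (leq_trans lt_c leN) h'g h's.
have [up|up] := boolP [forall k in ~: (j0 |: s0), 0 < excess x s0 h0 k]; last first.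
  exists m, u; split=> //; rewrite u0 /lower_hull.
  by rewrite (cells_crossing_upper gp1 s0d flat off off' up).
exists m.+1, (fun k => if k is k'.+1 then u k' else lower_hull x I h).
split=> // [[_|k]|[_|k]]; [exact: lower_hull_triangulation|exact: utri| |exact: uflip].
rewrite u0; split; first exact: crossing_flip flat off off' on up.
exact: crossing_Vr flat off off' on up neg.
Qed.

End FlipPath.

Theorem theorem4 (R : realType) (d n : nat) (x : 'I_n -> 'rV[R]_d)
    (x_inj : injective x) (n_gt_d : (d.+1 <= n)%N)
    (x_gp : general_position x)
    (t : {set {set 'I_n}})
    (t_tri : triangulation x [set: 'I_n]%SET t) (t_reg : regular x t) :
  exists (m : nat) (u : nat -> {set {set 'I_n}}),
    [/\ u 0%N = t,
        is_Delaunay x (u m),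
        forall k : nat, (k <= m)%N -> triangulation x [set: 'I_n]%SET (u k)
      & forall k : nat, (k < m)%N ->
          flip x (u k) (u k.+1) /\ Vr x (u k.+1) < Vr x (u k)].
Proof.
have gp1 := x_gp.1; have q_gen := paraboloid_generic x_inj x_gp.
have dI : (d < #|[set: 'I_n]%SET|)%N by rewrite cardsT card_ord.
have [f [g [f_cvx g_aff g_inj]]] := t_reg.
have [h [h_gen h_simple h_pos]] :=
  perturb_heights gp1 (regular_heights x t f) q_gen.
have tE : t = lower_hull x [set: 'I_n]%SET h.
  apply: triangulation_lower_hull => //; apply/fintype.subsetP => s st.
  move: (st); rewrite inE => /andP[_ /eqP sd].
  apply/lower_cellsP; split=> // j _ js.
  exact/h_pos/(regular_excess gp1 t_tri f_cvx g_aff g_inj).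
have [m [u [u0 um u_tri u_flip]]] := flip_path x_inj x_gp n_gt_d h_gen h_simple.
exists m, u; split=> //; first by rewrite u0 -tE.
split=> [|s sd]; first exact: u_tri.
by rewrite um maximal_lower_hull; exact: Delaunay_cell.
Qed.
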